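(* Let $k>0$. Consider the planar ($\nu=0$) isotropic Euler-Poisson equations $$n_t+(nu)_r=0,\qquad u_t+uu_r=-k\phi_r,\qquad \phi_{rr}=-n,\qquad r>0,\ t>0,$$ with initial data $(n,u)(r,0)=(n_0,u_0)(r)$, $n_0\ge0$, $u_0>0$. The smooth solution blows up in finite time if and only if $$\exists\,\alpha\in\mathbb{R}^+\quad\text{s.t.}\quad u_0'(\alpha)\le-\sqrt{2kn_0(\alpha)}.$$ In this case, the density $n(r,t)$ and $u_r(r,t)$ become infinite as $t\uparrow t_c$, where the blow-up time is given explicitly by $$t_c:=2\Big/\sup\left\{-u_0'(\alpha)+\sqrt{(u_0'(\alpha))^2-2kn_0(\alpha)}\right\},$$ the supremum being over the $\alpha\in\mathbb{R}^+$ with $u_0'(\alpha)\le-\sqrt{2kn_0(\alpha)}$.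
   Context: Initial data: $n_0,u_0\in C^1(\mathbb{R}^+)$. With $E=-\phi_r$, it is required that $E(0,t)=0$, i.e. $E(r,t)=\int_0^r n(\xi,t)\,d\xi$.
   Formalization: The blow-up criterion excludes α with n_0(α)=u_0'(α)=0 (n_0=0, u_0=1 is global), and n becoming infinite is claimed only if the supremum in t_c is approached along α with n_0(α) bounded below by a positive constant (n_0=0 gives n=0). *)

(* Defs.v *)
From HB Require Import structures.
From mathcomp Require Import all_boot all_order all_algebra.
From mathcomp Require Import all_classical all_reals all_analysis.

Set Implicit Arguments.
Unset Strict Implicit.
Unset Printing Implicit Defensive.

Import Order.TTheory GRing.Theory Num.Theory.
Import numFieldNormedType.Exports.

Local Open Scope classical_set_scope.
Local Open Scope ring_scope.

(* MathComp-Analysis development.  R^+ is the open half-line r > 0; functions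
   on R^+ are total functions whose values elsewhere are ignored. *)

Definition C1_pos (R : realType) (f : R -> R) : Prop :=
  forall r : R, 0 < r -> derivable f r 1 /\ {for r, continuous (derive1 f)}.

(* Integrability of n0 near 0 is what makes E(r,0) = \int_0^r n0 meaningful;
   it is automatic when n0 is C^1 up to r = 0. *)
Record admissible_data (R : realType) (n0 u0 : R -> R) : Prop := {
  data_n0_C1 : C1_pos n0 ;
  data_u0_C1 : C1_pos u0 ;
  data_n0_ge0 : forall r : R, 0 < r -> 0 <= n0 r ;
  data_u0_gt0 : forall r : R, 0 < r -> 0 < u0 r ;
  data_n0_int : forall r : R, 0 < r ->
    (@lebesgue_measure R).-integrable `]0, r[ (EFin \o n0)
}.

Definition dr (R : realType) (f : R -> R -> R) (r t : R) : R :=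
  derive1 (fun x : R => f x t) r.
Definition dt (R : realType) (f : R -> R -> R) (r t : R) : R :=
  derive1 (fun s : R => f r s) t.

(* X a t is the position at time t of the particle that starts at a > 0.
   As u0 > 0 and nothing enters through r = 0, the gas may detach from the
   origin (when u0(0+) > 0 it occupies r > u0(0+) t); when u0(0+) = 0 it
   occupies all of r > 0. *)
Definition gas (R : realType) (X : R -> R -> R) (t : R) : set R :=
  [set X a t | a in [set a : R | 0 < a]].

Definition gas_region (R : realType) (T : \bar R) (X : R -> R -> R) :
    set (R * R) :=
  [set p | [/\ 0 <= p.2, (p.2%:E < T)%E & gas X p.2 p.1]].

Definition label_region (R : realType) (T : \bar R) : set (R * R) :=
  [set p | [/\ 0 < p.1, 0 <= p.2 & (p.2%:E < T)%E]].

(* Smooth solution on 0 <= t < T, where T may be +oo.  For C^1 data the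
   natural class is u in C^1 and n in C^0: along particle paths
   n = n0 / (1 + u0' t + k n0 t^2 / 2), and u0' is only continuous, so n_r need
   not exist.  Hence n_t + (n u)_r = 0 is imposed in its integrated form
   d/dt \int_a^b n dr = (n u)(a,t) - (n u)(b,t); the other equations hold
   pointwise. *)
Record smooth_solution (R : realType) (k : R) (n0 u0 : R -> R) (T : \bar R)
    (n u phi X : R -> R -> R) : Prop := {
  sol_n_init : forall r : R, 0 < r -> n r 0 = n0 r ;
  sol_u_init : forall r : R, 0 < r -> u r 0 = u0 r ;

  sol_X_init : forall a : R, 0 < a -> X a 0 = a ;
  sol_X_pos : forall a t : R, 0 < a -> 0 <= t -> (t%:E < T)%E -> 0 < X a t ;
  sol_X_cont : {within label_region T,
    continuous (fun p : R * R => X p.1 p.2)} ;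
  sol_X_path : forall a t : R, 0 < a -> 0 < t -> (t%:E < T)%E ->
    is_derive t 1 (X a) (u (X a t) t) ;

  sol_n_cont : {within gas_region T X,
    continuous (fun p : R * R => n p.1 p.2)} ;
  sol_u_cont : {within gas_region T X,
    continuous (fun p : R * R => u p.1 p.2)} ;
  sol_u_der : forall r t : R, gas_region T X (r, t) ->
    derivable (fun x : R => u x t) r 1 ;
  sol_ur_cont : {within gas_region T X,
    continuous (fun p : R * R => dr u p.1 p.2)} ;
  sol_u_dert : forall r t : R, 0 < t -> gas_region T X (r, t) ->
    derivable (fun s : R => u r s) t 1 ;
  sol_ut_cont : {within gas_region T X `&` [set p | 0 < p.2],
    continuous (fun p : R * R => dt u p.1 p.2)} ;

  sol_vacuum : forall r t : R, 0 < r -> 0 <= t -> (t%:E < T)%E ->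
    ~ gas X t r -> n r t = 0 ;

  sol_mass : forall a b t : R, 0 < t -> (t%:E < T)%E ->
    gas X t a -> gas X t b -> a < b ->
    is_derive t 1
      (fun s : R => \int[@lebesgue_measure R]_(x in `[a, b]) n x s)
      (n a t * u a t - n b t * u b t) ;

  sol_momentum : forall r t : R, 0 < t -> gas_region T X (r, t) ->
    dt u r t + u r t * dr u r t = - k * dr phi r t ;

  sol_poisson : forall r t : R, gas_region T X (r, t) ->
    is_derive r 1 (fun x : R => dr phi x t) (- n r t) ;
  (* E = - phi_r satisfies E(0,t) = 0, i.e. E(r,t) = \int_0^r n *)
  sol_n_int : forall r t : R, 0 < r -> 0 <= t -> (t%:E < T)%E ->
    (@lebesgue_measure R).-integrable `]0, r[ (EFin \o (fun x : R => n x t)) ;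
  sol_field : forall r t : R, 0 < r -> 0 <= t -> (t%:E < T)%E ->
    is_derive r 1 (fun x : R => phi x t)
      (- \int[@lebesgue_measure R]_(x in `]0, r[) n x t)
}.

(* [0, 0) always carries the trivial solution, so lifespan >= 0. *)
Definition lifespan (R : realType) (k : R) (n0 u0 : R -> R) : \bar R :=
  ereal_sup [set T | (0 <= T)%E /\
    exists n u phi X, smooth_solution k n0 u0 T n u phi X].

Definition blows_up (R : realType) (k : R) (n0 u0 : R -> R) : Prop :=
  (lifespan k n0 u0 < +oo)%E.

Definition critical (R : realType) (k : R) (n0 u0 : R -> R) : set R :=
  [set a | 0 < a /\ derive1 u0 a <= - Num.sqrt (2 * k * n0 a)].

Definition rate (R : realType) (k : R) (n0 u0 : R -> R) (a : R) : R :=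
  - derive1 u0 a + Num.sqrt ((derive1 u0 a) ^+ 2 - 2 * k * n0 a).

Definition sup_rate (R : realType) (k : R) (n0 u0 : R -> R) (A : set R) :
    \bar R :=
  ereal_sup [set (rate k n0 u0 a)%:E | a in A].

(* On \bar R, 2 / +oo = 0 and 2 / 0 = +oo. *)
Definition tc (R : realType) (k : R) (n0 u0 : R -> R) : \bar R :=
  (2%:E / sup_rate k n0 u0 (critical k n0 u0))%E.

(* The supremum defining tc is approached along particles whose initial density
   stays away from 0 (for instance, attained at a particle with n0 > 0).  Without
   this the density may stay bounded at tc: if n0 = 0 everywhere, so is n. *)
Definition dense_criticality (R : realType) (k : R) (n0 u0 : R -> R) : Prop :=
  exists c : R, 0 < c /\
    sup_rate k n0 u0 (critical k n0 u0 `&` [set a | c <= n0 a]) =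
    sup_rate k n0 u0 (critical k n0 u0).

(* Main.v *)
(* Along a particle path X(a, .) the field E = - phi_r is constant: the mass
   between two particles is conserved and there is vacuum below the innermost
   particle.  So X(a, t) = a + u0(a) t + k E0(a) t^2 / 2 with
   E0(a) = \int_0^a n0, and n and u_r are n0 / J and J_t / J for
   J = X_a = 1 + u0'(a) t + k n0(a) t^2 / 2.  A Gronwall estimate for
   X(b, t) - X(a, t) forces J > 0 on the lifespan of any smooth solution;
   conversely, where J > 0 the flow can be inverted and defines a solution.
   The first positive zero of the quadratic J is 2 / rate(a) when a is critical,
   and there is none otherwise. *)

Require Import Defs.
From HB Require Import structures.
From mathcomp Require Import all_boot all_order all_algebra.
From mathcomp Require Import all_classical all_reals all_analysis.
From mathcomp Require Import measurable_realfun ring lra.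

Set Implicit Arguments.
Unset Strict Implicit.
Unset Printing Implicit Defensive.

Import Order.TTheory GRing.Theory Num.Theory.
Import numFieldNormedType.Exports.

Local Open Scope classical_set_scope.
Local Open Scope ring_scope.

(** * Calculus along curves *)

(** The delicate point is the constancy of the field along a path. Since [n] is only continuous, the
    continuity equation cannot be differentiated along paths; conservation between two particles
    comes from [sol_mass] at frozen endpoints plus a chain rule for moving ones. Two boundaries
    remain. At t = 0 nothing says that the integrals of [n] over an interval converge to those of
    [n0], so the comparison is made on the derivative in the label, which only involves [n] close to
    one point (b, 0). At r = 0 the mass below a particle is trapped by letting the label tend to 0.
    Existence on [0, T) then becomes [rate a * t < 2] for all critical [a] and all t < T. This
    condition concerns only times below T, so it passes to T = [tc] and the supremum of lifespans is
    attained. The supremum of the rates may not be: the particle that witnesses divergence has to be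
    chosen anew for each t close to [tc]. *)

Lemma near_prodP (R : realType) (P : R * R -> Prop) (x0 t0 : R) :
  (\forall p \near (x0, t0), P p) <->
  exists2 e : R, 0 < e &
    forall x t, `|x - x0| < e -> `|t - t0| < e -> P (x, t).
Proof.
split=> [/nbhs_ballP[e /= e0 eP]|[e e0 eP]].
  by exists e => // x t xe te; apply: eP; split; rewrite /= -ball_normE /= distrC.
apply/nbhs_ballP; exists e => // -[x t] [/=].
by rewrite -!ball_normE /= distrC (distrC t0); exact: eP.
Qed.

(** Endpoints are left unordered because positions on a curve, or of two particles not yet known to
    keep their order, come in no known order. *)
Lemma MVT_minmax (R : realType) (f df : R -> R) (p q : R) :
  (forall x, Num.min p q <= x <= Num.max p q -> is_derive x 1 f (df x)) ->
  exists x, Num.min p q <= x <= Num.max p q /\ f q - f p = df x * (q - p).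
Proof.
wlog pq : p q / p <= q => [H D|D].
  have /orP[pq|qp] := le_total p q; first exact: H.
  have [|x [x1 e]] := H q p qp; first by rewrite minC maxC.
  by exists x; split; [rewrite minC maxC|rewrite -[LHS]opprB e -mulrN opprB].
move: D; rewrite (min_idPl pq) (max_idPr pq) => D.
have [x xpq||x xpq e] := @MVT_segment _ f df _ _ pq.
- by apply: D; have := subset_itv_oo_cc xpq; rewrite /= in_itv.
- by apply: derivable_within_continuous => x; rewrite in_itv => /D[].
- by exists x; move: xpq; rewrite in_itv.
Qed.

(** [Q] is the difference quotient in x at time s, completed by [fr] where the two points coincide.
    By the mean value theorem it is a value of [fr] at a point squeezed towards [X t0], whence its
    continuity. *)
Lemma slope_along (R : realType) (f fr : R -> R -> R) (X : R -> R) (t0 : R) :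
  (\forall p \near (X t0, t0),
     is_derive (p.1 : R) 1 (fun x => f x p.2) (fr p.1 p.2)) ->
  {for (X t0, t0), continuous (fun p : R * R => fr p.1 p.2)} ->
  {for t0, continuous X} ->
  exists Q : R -> R, [/\ {for t0, continuous Q}, Q t0 = fr (X t0) t0 &
    \forall s \near t0, f (X s) s - f (X t0) s = Q s * (X s - X t0)].
Proof.
move=> df cfr cX.
have cXf : forall P : R * R -> Prop, (\forall p \near (X t0, t0), P p) ->
    \forall s \near t0, forall x, `|x - X t0| <= `|X s - X t0| -> P (x, s).
  move=> P /near_prodP[e e0 eP].
  near=> s => x xs; apply: eP.
    rewrite (le_lt_trans xs)// distrC.
    by near: s; move/cvgrPdist_lt : cX; apply.
  by rewrite distrC; near: s; apply: nbhsx_ballx.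
have mvt : \forall s \near t0, exists2 x, `|x - X t0| <= `|X s - X t0| &
    f (X s) s - f (X t0) s = fr x s * (X s - X t0).
  near=> s.
  have ds : forall x, `|x - X t0| <= `|X s - X t0| ->
      is_derive x 1 (fun x => f x s) (fr x s).
    by near: s; exact: (cXf (fun p => is_derive p.1 1 (fun x => f x p.2) (fr p.1 p.2)) df).
  have [|x [/andP[x1 x2] e]] := @MVT_minmax _ (fun x => f x s) (fr^~ s) (X t0) (X s).
    move=> x /andP[x1 x2]; apply: ds.
    by move: x1 x2; case: (leP (X t0) (X s)) => pX ? ?;
      [rewrite !ger0_norm|rewrite !ler0_norm]; lra.
  exists x => //; move: x1 x2; case: (leP (X t0) (X s)) => pX ? ?;
    by [rewrite !ger0_norm; lra|rewrite !ler0_norm; lra].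
pose Q s := if X s == X t0 then fr (X t0) t0
            else (f (X s) s - f (X t0) s) / (X s - X t0).
have Q0 : Q t0 = fr (X t0) t0 by rewrite /Q eqxx.
exists Q; split => //; last first.
  near=> s; rewrite /Q; case: eqP => [->|/eqP]; first by rewrite !subrr mulr0.
  by rewrite -subr_eq0 => /divfK ->.
rewrite /prop_for /continuous_at Q0; apply/cvgrPdist_lt => e e0.
near=> s; rewrite /Q; case: eqP => [_|/eqP XX]; first by rewrite subrr normr0.
have [x xs ->] : exists2 x, `|x - X t0| <= `|X s - X t0| &
    f (X s) s - f (X t0) s = fr x s * (X s - X t0) by near: s.
rewrite mulfK ?subr_eq0//; move: x xs; near: s.
by apply: (cXf (fun p => `|fr (X t0) t0 - fr p.1 p.2| < e));
  move/cvgrPdist_lt : cfr; apply.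
Unshelve. all: by end_near. Qed.

Lemma is_derive_along (R : realType) (f fr : R -> R -> R) (X : R -> R)
    (t0 dX ft : R) :
  (\forall p \near (X t0, t0),
     is_derive (p.1 : R) 1 (fun x => f x p.2) (fr p.1 p.2)) ->
  {for (X t0, t0), continuous (fun p : R * R => fr p.1 p.2)} ->
  is_derive t0 1 X dX -> is_derive t0 1 (f (X t0)) ft ->
  is_derive t0 1 (fun s => f (X s) s) (fr (X t0) t0 * dX + ft).
Proof.
move=> df cfr DX Df.
have cX : {for t0, continuous X}.
  by apply/differentiable_continuous/derivable1_diffP; case: DX.
have [Q [cQ Q0 Qe]] := slope_along df cfr cX.
have [gX [gXe cgX gX0]] := (is_derive1_caratheodory _ _ _).1 DX.
have [gf [gfe cgf gf0]] := (is_derive1_caratheodory _ _ _).1 Df.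
pose h s := f (X t0) t0 + (Q s * gX s + gf s) * (s - t0).
apply: (@near_eq_is_derive _ _ _ h).
  near=> s; rewrite /h mulrDl -mulrA -gXe -gfe.
  rewrite -(_ : f (X s) s - f (X t0) s = Q s * (X s - X t0)); last by near: s.
  by rewrite addrA; lra.
apply/is_derive1_caratheodory; exists (fun s => Q s * gX s + gf s); split.
- by move=> z; rewrite /h subrr mulr0 addr0 addrC addKr.
- by apply: continuousD => //; apply: continuousM.
- by rewrite Q0 gX0 gf0.
Unshelve. all: by end_near. Qed.

(** With the same splitting, constancy of [f (X s) s] reads
    [Q s * (X s - X t0) = - gf s * (s - t0)]. Dividing by [Q s] yields differentiability of the
    merely continuous [X]. *)
Lemma is_derive_implicit (R : realType) (f fr : R -> R -> R) (X : R -> R)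
    (t0 ft : R) :
  (\forall p \near (X t0, t0),
     is_derive (p.1 : R) 1 (fun x => f x p.2) (fr p.1 p.2)) ->
  {for (X t0, t0), continuous (fun p : R * R => fr p.1 p.2)} ->
  {for t0, continuous X} -> is_derive t0 1 (f (X t0)) ft ->
  fr (X t0) t0 != 0 ->
  (\forall s \near t0, f (X s) s = f (X t0) t0) ->
  is_derive t0 1 X (- ft / fr (X t0) t0).
Proof.
move=> df cfr cX Df fr0 fX.
have [Q [cQ Q0 Qe]] := slope_along df cfr cX.
have [gf [gfe cgf gf0]] := (is_derive1_caratheodory _ _ _).1 Df.
pose h s := X t0 + (- gf s / Q s) * (s - t0).
apply: (@near_eq_is_derive _ _ _ h).
  near=> s; have Qs0 : Q s != 0.
    near: s; move/cvgrPdist_lt : cQ => /(_ `|Q t0|).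
    rewrite Q0 normr_gt0 => /(_ fr0); apply: filterS => s; apply: contraTneq => ->.
    by rewrite subr0 ltxx.
  have e1 : f (X s) s - f (X t0) s = Q s * (X s - X t0) by near: s.
  have e2 : f (X s) s = f (X t0) t0 by near: s.
  apply: (mulfI Qs0); rewrite /h mulrDr mulrA [Q s * (_ / _)]mulrC divfK//.
  by rewrite mulNr -gfe -e2 opprB e1; ring.
apply/is_derive1_caratheodory; exists (fun s => - gf s / Q s); split.
- by move=> z; rewrite /h subrr mulr0 addr0 addrC addKr.
- by apply: continuousM; [apply: continuousN|apply: continuousV => //; rewrite Q0].
- by rewrite Q0 gf0.
Unshelve. all: by end_near. Qed.

Lemma is_derive_normP (R : realType) (f : R -> R) (x l : R) :
  is_derive x 1 f l <-> forall e, 0 < e -> exists2 d, 0 < d &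
    forall y, `|y - x| < d -> `|f y - f x - l * (y - x)| <= e * `|y - x|.
Proof.
split=> [/is_derive1_caratheodory[g [fg cg <-]] e e0|H].
  move/cvgrPdist_le : cg => /(_ e e0) /nbhs_ballP[d /= d0 Hd].
  exists d => // y yx; rewrite fg -mulrBl normrM ler_wpM2r// distrC; apply: Hd.
  by rewrite -ball_normE /= distrC.
apply/is_derive1_caratheodory.
exists (fun y => if y == x then l else (f y - f x) / (y - x)); split; last by rewrite eqxx.
  by move=> y; case: eqP => [->|/eqP]; rewrite ?subrr ?mulr0// -subr_eq0 => /divfK->.
rewrite /prop_for /continuous_at eqxx; apply/cvgrPdist_le => e e0.
have [d d0 Hd] := H e e0; apply/nbhs_ballP; exists d => // y.
rewrite /ball /= distrC => yx.
case: eqP => [_|/eqP]; first by rewrite subrr normr0 ltW.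
rewrite -subr_eq0 => yx0; rewrite -(ler_pM2r (_ : 0 < `|y - x|)) ?normr_gt0//.
by rewrite -normrM mulrBl divfK// distrC; exact: Hd.
Qed.

(** * The mass function *)

(** This is the field E when [f] is a density. For r <= 0 the interval is empty and the value is 0,
    so continuity at 0 expresses that little mass lies near the origin. *)
Definition mass (R : realType) (f : R -> R) (r : R) : R :=
  \int[@lebesgue_measure R]_(x in `]0, r[) f x.

Lemma continuous_mass (R : realType) (f : R -> R) :
  (forall r, 0 < r -> (@lebesgue_measure R).-integrable `]0, r[ (EFin \o f)) ->
  continuous (mass f).
Proof.
move=> intf r.
(* Extension by 0 below the origin makes [r] interior to [[- b, b]], also when r <= 0. *)
pose b := `|r| + 1; pose g := f \_ `]0, b[.
have b0 : 0 < b by rewrite ltr_wpDl.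
have intg : (@lebesgue_measure R).-integrable `[- b, b] (EFin \o g).
  rewrite /g -restrict_EFin; apply/integrable_restrict => //.
  rewrite setIidr; first exact: intf.
  by move=> x /=; rewrite !in_itv/= => /andP[x0 xb]; apply/andP; split; lra.
have rb : r \in `]- b, b[%R.
  rewrite in_itv/= /b; apply/andP; split.
    by rewrite ltrNl (le_lt_trans (ler_norm _))// normrN; lra.
  by rewrite (le_lt_trans (ler_norm _))//; lra.
have bb : - b < b by lra.
have C := parameterized_integral_continuous (ltW bb) intg.
have {}C : {for r, continuous (fun x =>
    parameterized_integral (@lebesgue_measure R) (- b) x g)}.
  move/(continuous_within_itvP _ bb) : C => [C _ _].
  exact: C.
have E x : x \in `]- b, b[%R ->
    parameterized_integral (@lebesgue_measure R) (- b) x g = mass f x.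
  move=> xb; rewrite /parameterized_integral -Rintegral_itv_bndo_bndc; last first.
    apply: integrableS intg => //; apply: subset_itvl.
    by rewrite bnd_simp ltW// (itvP xb).
  rewrite /g Rintegral_mkcond -patch_setI -Rintegral_mkcond /mass; congr Rintegral.
  apply/seteqP; split => y /=; rewrite !in_itv/=.
    by move=> [/andP[_ ->] /andP[-> _]].
  move=> /andP[y0 yx]; split; apply/andP; split => //; first lra.
  by rewrite (lt_trans yx)// (itvP xb).
move: C; rewrite /prop_for /continuous_at E//; apply: cvg_trans.
apply: near_eq_cvg; near=> x; apply: E.
by near: x; exact: near_in_itvoo.
Unshelve. all: by end_near. Qed.

Lemma is_derive_mass (R : realType) (f : R -> R) (r : R) :
  (forall r, 0 < r -> (@lebesgue_measure R).-integrable `]0, r[ (EFin \o f)) ->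
  0 < r -> {for r, continuous f} -> is_derive r 1 (mass f) (f r).
Proof.
move=> intf r0 cf.
have r1 : r < r + 1 by lra.
have iC x : 0 < x -> (@lebesgue_measure R).-integrable `]0, x] (EFin \o f).
  move=> x0; apply: integrableS (intf (x + 1) _) => //; last lra.
  by apply: subset_itvl; rewrite bnd_simp; lra.
have r2 : 0 < r + 1 by lra.
have [|/= D1 D2] := @continuous_FTC1 R f (BRight 0) r (r + 1) r1 (iC _ r2) _ cf.
  by rewrite lte_fin.
apply: (@near_eq_is_derive _ _ _ _ (mass f)); last first.
  by rewrite -D2 derive1E; apply/derivableP; exact: D1.
near=> x; rewrite /mass Rintegral_itv_bndo_bndc//; apply: intf.
by near: x; exact: lt_nbhsr.
Unshelve. all: by end_near. Qed.

Lemma mass_sub (R : realType) (f : R -> R) (a b : R) :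
  (forall r, 0 < r -> (@lebesgue_measure R).-integrable `]0, r[ (EFin \o f)) ->
  0 < a -> a < b ->
  mass f b - mass f a = \int[@lebesgue_measure R]_(x in `[a, b]) f x.
Proof.
move=> intf a0 ab.
have iC x : 0 < x -> (@lebesgue_measure R).-integrable `]0, x] (EFin \o f).
  move=> x0; apply: integrableS (intf (x + 1) _) => //; last lra.
  by apply: subset_itvl; rewrite bnd_simp; lra.
have b0 : 0 < b by lra.
rewrite /mass (Rintegral_itv_bndo_bndc (intf _ b0)).
rewrite (Rintegral_itv_bndo_bndc (intf _ a0)) Rintegral_itvB ?bnd_simp//.
- rewrite Rintegral_itv_obnd_cbnd//; apply: integrableS (iC _ b0) => //.
  by apply: subset_itvr; rewrite bnd_simp; lra.
- exact: iC.
- exact: ltW.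
- exact: ltW.
Qed.

Lemma mass_ext (R : realType) (f g : R -> R) (r : R) :
  (forall x, 0 < x < r -> f x = g x) -> mass f r = mass g r.
Proof.
by move=> fg; apply: eq_Rintegral => x; rewrite inE/= in_itv/=; exact: fg.
Qed.

Lemma mass_eq0 (R : realType) (f : R -> R) (r : R) :
  (forall x, 0 < x < r -> f x = 0) -> mass f r = 0.
Proof.
move=> f0; rewrite (@mass_ext _ f (cst 0))//.
by rewrite /mass /Rintegral integral0.
Qed.

(** * Smooth solutions follow the explicit flow *)

Lemma within_normP (R : realType) (A : set R) (f : R -> R) :
  {within A, continuous f} <->
  forall x, A x -> forall e, 0 < e -> exists2 d, 0 < d &
    forall y, `|y - x| < d -> A y -> `|f y - f x| < e.
Proof.
rewrite subspace_continuousP; split=> H x Ax.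
  move=> e e0; move/cvgrPdist_lt : (H x Ax) => /(_ e e0).
  move=> /nbhs_ballP[d /= d0 Hd]; exists d => // y yx Ay.
  by rewrite distrC; apply: Hd => //; rewrite -ball_normE /= distrC.
apply/cvgrPdist_lt => e e0; have [d d0 Hd] := H x Ax e e0.
apply/nbhs_ballP; exists d => // y; rewrite -ball_normE /= distrC => yx Ay.
by rewrite distrC; apply: Hd.
Qed.

Lemma within_prod_normP (R : realType) (D : set (R * R)) (f : R * R -> R) :
  {within D, continuous f} <->
  forall x t, D (x, t) -> forall e, 0 < e -> exists2 d, 0 < d &
    forall y s, `|y - x| < d -> `|s - t| < d -> D (y, s) ->
      `|f (y, s) - f (x, t)| < e.
Proof.
rewrite subspace_continuousP; split=> H.
  move=> x t Dxt e e0; move/cvgrPdist_lt : (H _ Dxt) => /(_ e e0).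
  rewrite near_withinE => /near_prodP[d d0 Hd]; exists d => // y s yx st Dys.
  by rewrite distrC; apply: Hd.
move=> [x t] Dxt; apply/cvgrPdist_lt => e e0; have [d d0 Hd] := H x t Dxt e e0.
rewrite near_withinE; apply/near_prodP; exists d => // y s yx st Dys.
by rewrite distrC; apply: Hd.
Qed.

(** * Separation of particle paths *)

Section lagrangian.
Context (R : realType) (k : R) (n0 u0 : R -> R) (T : \bar R)
  (n u phi X : R -> R -> R).
Hypothesis S : smooth_solution k n0 u0 T n u phi X.

Lemma gas_regionX (a t : R) : 0 < a -> 0 <= t -> (t%:E < T)%E ->
  gas_region T X (X a t, t).
Proof. by move=> a0 t0 tT; split => //; exists a. Qed.

Lemma trajectory_within (a t : R) : 0 < a -> (t%:E < T)%E ->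
  {within `[0, t], continuous (X a)}.
Proof.
move=> a0 tT; apply/within_normP => s; rewrite /= in_itv/= => /andP[s0 st] e e0.
have sT : (s%:E < T)%E by rewrite (le_lt_trans _ tT)// lee_fin.
have Das : label_region T (a, s) by [].
have [d d0 H] := (within_prod_normP _ _).1 (sol_X_cont S) _ _ Das _ e0.
exists d => // y ys; rewrite in_itv/= => /andP[y0 yt].
apply: (H a y) => //; first by rewrite subrr normr0.
by split => //=; rewrite (le_lt_trans _ tT)// lee_fin.
Qed.

Lemma flow_within (a b t : R) : 0 < a -> 0 <= t -> (t%:E < T)%E ->
  {within `[a, b], continuous (X^~ t)}.
Proof.
move=> a0 t0 tT; apply/within_normP => c; rewrite /= in_itv/= => /andP[ac cb] e e0.
have Dct : label_region T (c, t) by split => //=; lra.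
have [d d0 H] := (within_prod_normP _ _).1 (sol_X_cont S) _ _ Dct _ e0.
exists d => // y yc; rewrite in_itv/= => /andP[ay yb].
by apply: (H y t) => //; [rewrite subrr normr0|split => //=; lra].
Qed.

(** In labels, the gas between two particles up to time t is the image of the compact rectangle
    [[a, b] x [0, t]], on which [dr u] composed with the flow is continuous. *)
Lemma velocity_gradient_bounded (a b t : R) : 0 < a -> a <= b -> 0 <= t ->
  (t%:E < T)%E ->
  exists2 L : R, 0 <= L & forall c s : R, a <= c <= b -> 0 <= s <= t ->
    `|dr u (X c s) s| <= L.
Proof.
move=> a0 ab t0 tT.
pose A : set (R * R) := `[a, b] `*` `[0, t].
have cA : compact A by apply: compact_setX; exact: segment_compact.
have A0 : A !=set0 by exists (a, 0); split; rewrite /= in_itv/= lexx ?ab ?t0.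
have Areg c s : A (c, s) -> 0 < c /\ (s%:E < T)%E.
  move=> [/=]; rewrite !in_itv/= => /andP[ac _] /andP[_ st]; split; first lra.
  by rewrite (le_lt_trans _ tT)// lee_fin.
have : {within A, continuous (fun p : R * R => `|dr u (X p.1 p.2) p.2|)}.
  apply/within_prod_normP => c s Acs e e0.
  have [c0 sT] := Areg _ _ Acs.
  have s0 : 0 <= s by case: Acs => _ /=; rewrite in_itv/= => /andP[].
  have [d d0 H] := (within_prod_normP _ _).1 (sol_ur_cont S) _ _
    (gas_regionX c0 s0 sT) _ e0.
  have Dcs : label_region T (c, s) by [].
  have [d' d'0 H'] := (within_prod_normP _ _).1 (sol_X_cont S) _ _ Dcs _ d0.
  exists (Num.min d d'); first by rewrite lt_min d0.
  move=> y r; rewrite !lt_min => /andP[_ yc] /andP[rs rs'] Ayr.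
  have [y0 rT] := Areg _ _ Ayr.
  have r0 : 0 <= r by case: Ayr => _ /=; rewrite in_itv/= => /andP[].
  rewrite (le_lt_trans (ler_dist_dist _ _))//.
  by apply: H => //; [apply: H'|exact: gas_regionX].
move=> /(compact_EVT_max A0 cA)[[c s] Acs H].
exists `|dr u (X c s) s| => // y r yab rst.
by apply: (H (y, r)); rewrite inE; split; rewrite /= in_itv.
Qed.

(* With |d' | <= L |d| for d := X b - X a, the function d ^ 2 * exp (2 L t) is
   nondecreasing. *)
Lemma flow_increment (a b t : R) : 0 < a -> a <= b -> 0 <= t -> (t%:E < T)%E ->
  exists2 c : R, 0 < c & forall x y : R, a <= x -> x <= y -> y <= b ->
    c * (y - x) <= X y t - X x t.
Proof.
move=> a0 ab t0 tT; have [L L0 HL] := velocity_gradient_bounded a0 ab t0 tT.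
(* The constant is the same for all pairs of labels in [[a, b]]; this uniformity later gives
   [0 < jac] instead of [0 <= jac]. *)
exists (expR (- (L * t))); first exact: expR_gt0.
move=> x y ax; rewrite le_eqVlt => /predU1P[->|xy] yb; first by rewrite !subrr mulr0.
have x0 : 0 < x by lra.
have y0 : 0 < y by lra.
pose d s := X y s - X x s.
have cd : {within `[0, t], continuous d}.
  by move=> s; apply: continuousB; apply: trajectory_within.
have dd (s : R) : s \in `]0, t[%R -> exists2 w, `|w| <= L & is_derive s 1 d (w * d s).
  rewrite in_itv/= => /andP[s0 st].
  have sT : (s%:E < T)%E by rewrite (lt_trans _ tT)// lte_fin.
  (* Every intermediate position is occupied by a particle with label in [[x, y]], so [dr u] is the
     derivative of [u] there and is bounded by [L]. *)
  have between (z : R) : Num.min (X x s) (X y s) <= z <= Num.max (X x s) (X y s) ->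
      exists2 c, x <= c <= y & X c s = z.
    move=> zxy; have [|c] := @IVT R (X^~ s) x y z (ltW xy) _ zxy.
      exact: flow_within (ltW s0) _.
    by rewrite in_itv/=; exists c.
  have [|z [zxy e]] := @MVT_minmax _ (u^~ s) (fun z => dr u z s) (X x s) (X y s).
    move=> z /between[c /andP[xc cy] <-]; rewrite /dr derive1E; apply/derivableP.
    by apply: (sol_u_der S); apply: gas_regionX => //; [lra|exact: ltW].
  have [c /andP[xc cy] cz] := between _ zxy.
  exists (dr u z s); first by rewrite -cz HL//; lra.
  rewrite -e; apply: is_deriveB; exact: (sol_X_path S).
have d_ge (s : R) : 0 <= s <= t -> (y - x) ^+ 2 * expR (- (2 * L * s)) <= d s ^+ 2.
  move=> /andP[s0 st].
  pose h s := d s ^+ 2 * expR (2 * L * s).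
  have dh r : r \in `]0, t[%R -> exists2 v, 0 <= v & is_derive r 1 h v.
    move=> /dd[w wL D].
    exists (2 * d r ^+ 2 * expR (2 * L * r) * (w + L)).
      apply: mulr_ge0.
        by apply: mulr_ge0 (expR_ge0 _); apply: mulr_ge0 (sqr_ge0 _).
      by move: wL; rewrite ler_norml => /andP[]; lra.
    have := @is_derive_expR R (2 * L * r) => E.
    apply: is_derive_eq.
    by rewrite /GRing.scale/=; ring.
  have : h 0 <= h s.
    apply: (@ger0_derive1_le_cc R h 0 t) => //; rewrite ?in_itv/= ?lexx ?s0//.
    - by move=> r /dh[v _ []].
    - by move=> r /dh[v v0 D]; rewrite derive1E derive_val.
    - apply/subspace_continuousP => r r0t; apply: cvgM.
        move/subspace_continuousP : cd => /(_ r r0t) cdr.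
        by rewrite expr2; under eq_fun do rewrite expr2; apply: cvgM.
      apply: cvg_within_filter; apply: continuous_comp; last exact: continuous_expR.
      exact: mulrl_continuous.
  rewrite /h /d !(sol_X_init S)// mulr0 expR0 mulr1 => H.
  by rewrite expRN ler_pdivrMr ?expR_gt0.
(* The lower bound on [d ^+ 2] keeps [d] from vanishing, so [d] retains its initial sign. *)
have dpos : 0 < d t.
  rewrite ltNge; apply/negP => dt0.
  have [|s] := @IVT R d 0 t 0 t0 cd.
    have d0 : d 0 = y - x by rewrite /d !(sol_X_init S).
    by rewrite ge_min le_max dt0 orbT /= d0 subr_ge0 ltW.
  rewrite in_itv/= => st ds; have := d_ge s st.
  rewrite ds expr0n/= leNgt mulr_gt0 ?expR_gt0// exprn_gt0//; lra.
rewrite -[_ * _]ger0_norm; last by rewrite mulr_ge0 ?expR_ge0//; lra.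
rewrite -[X y t - _]/(d t) -(ger0_norm (ltW dpos)) -ler_sqr ?nnegrE//.
rewrite !real_normK ?num_real//.
have := d_ge t; rewrite t0 lexx => /(_ isT); apply: le_trans.
rewrite exprMn mulrC -expRM_natl.
by have -> : 2%:R * - (L * t) = - (2 * L * t) by ring.
Qed.

End lagrangian.

Lemma ltT_le (R : realType) (T : \bar R) (s t : R) :
  (t%:E < T)%E -> s <= t -> (s%:E < T)%E.
Proof. by move=> tT st; rewrite (le_lt_trans _ tT)// lee_fin. Qed.

Lemma near_ltT (R : realType) (T : \bar R) (t : R) :
  (t%:E < T)%E -> \forall s \near t, (s%:E < T)%E.
Proof.
case: T => [T|_|//]; last by near=> s; rewrite ltry.
by rewrite lte_fin => tT; near=> s; rewrite lte_fin; near: s; exact: lt_nbhsl.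
Unshelve. all: by end_near. Qed.

Lemma within_near_continuous (R : realType) (D : set (R * R)) (f : R * R -> R)
    (p : R * R) :
  {within D, continuous f} -> (\forall q \near p, D q) -> {for p, continuous f}.
Proof.
move=> /subspace_continuousP cf Dp; have fp := cf p (nbhs_singleton Dp).
apply: cvg_trans fp; apply: cvg_app => A; rewrite /= /nbhs /= /within /=.
by apply: filter_app; apply: filterS Dp => q Dq; apply.
Qed.

Lemma between_perturb (R : realType) (lo hi lo' hi' r y h : R) :
  `|y - r| < h -> `|lo - lo'| < h -> `|hi - hi'| < h ->
  h <= (r - lo) / 2 -> h <= (hi - r) / 2 -> lo' < y < hi'.
Proof.
rewrite !ltr_norml => /andP[? ?] /andP[? _] /andP[_ ?] ? ?.
by apply/andP; split; lra.
Qed.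

(** The particles [a / 2] and [2 * a] enclose [X a t]; moving continuously, they still enclose
    nearby points at nearby times. The flow properties are hypotheses because the lemma serves both
    a given solution and the flow constructed later. *)
Lemma interior_gas_region (R : realType) (T : \bar R) (X : R -> R -> R) (a t : R) :
  (forall a b t : R, 0 < a -> a < b -> 0 <= t -> (t%:E < T)%E -> X a t < X b t) ->
  (forall a b t r : R, 0 < a -> a <= b -> 0 <= t -> (t%:E < T)%E ->
    X a t <= r <= X b t -> gas X t r) ->
  (forall a t : R, 0 < a -> 0 < t -> (t%:E < T)%E -> {for t, continuous (X a)}) ->
  0 < a -> 0 < t -> (t%:E < T)%E ->
  \forall p \near (X a t, t), gas_region T X p.
Proof.
move=> lt_flow betw cX a0 t0 tT.
have b0 : 0 < a / 2 by lra.
have lo : X (a / 2) t < X a t by apply: lt_flow => //; lra.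
have hi : X a t < X (2 * a) t by apply: lt_flow => //; lra.
pose e := Num.min ((X a t - X (a / 2) t) / 2) ((X (2 * a) t - X a t) / 2).
have e0 : 0 < e by rewrite lt_min; apply/andP; split; lra.
have e1 : e <= (X a t - X (a / 2) t) / 2 by rewrite ge_min lexx.
have e2 : e <= (X (2 * a) t - X a t) / 2 by rewrite ge_min lexx orbT.
clearbody e.
have /cvgrPdist_lt/(_ e e0) near_lo : X (a / 2) s @[s --> t] --> X (a / 2) t.
  exact: cX.
have /cvgrPdist_lt/(_ e e0) near_hi : X (2 * a) s @[s --> t] --> X (2 * a) t.
  by apply: cX => //; lra.
have near_t : \forall s \near t, [/\ 0 < s, (s%:E < T)%E,
    `|X (a / 2) t - X (a / 2) s| < e & `|X (2 * a) t - X (2 * a) s| < e].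
  near=> s; split; near: s => //; [exact: lt_nbhsr|exact: near_ltT].
have [d /= d0 Hd] := near_t.
apply/near_prodP; exists (Num.min d e); first by rewrite lt_min d0.
move=> r s; rewrite !lt_min => /andP[_ re] /andP[sd _].
have [|s0 sT lo' hi'] := Hd s; first by rewrite /= distrC.
split => //=; first exact: ltW.
apply: (betw (a / 2) (2 * a)) => //; [lra|exact: ltW|].
by have /andP[/ltW-> /ltW->] := between_perturb re lo' hi' e1 e2.
Unshelve. all: by end_near. Qed.

(** * Conservation of mass between two particles *)

Section lagrangian_solution.
Context (R : realType) (k : R) (n0 u0 : R -> R) (T : \bar R)
  (n u phi X : R -> R -> R).
Hypothesis S : smooth_solution k n0 u0 T n u phi X.

Lemma flow_lt (a b t : R) : 0 < a -> a < b -> 0 <= t -> (t%:E < T)%E ->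
  X a t < X b t.
Proof.
move=> a0 ab t0 tT; have [c c0 H] := flow_increment S a0 (ltW ab) t0 tT.
have := H a b (lexx _) (ltW ab) (lexx _).
have : 0 < c * (b - a) by rewrite mulr_gt0 ?subr_gt0.
lra.
Qed.

Lemma gas_between (a b t r : R) : 0 < a -> a <= b -> 0 <= t -> (t%:E < T)%E ->
  X a t <= r <= X b t -> gas X t r.
Proof.
move=> a0 ab t0 tT /andP[ar rb].
have [||c] := @IVT R (X^~ t) a b r ab.
- exact (@flow_within _ _ _ _ _ _ _ _ _ S a b t a0 t0 tT).
- by rewrite ge_min le_max ar rb orbT.
- by rewrite in_itv/= => /andP[ac cb] <-; exists c => //=; lra.
Qed.

Lemma gas_gt0 (r t : R) : 0 <= t -> (t%:E < T)%E -> gas X t r -> 0 < r.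
Proof. by move=> t0 tT [a a0 <-]; apply: (sol_X_pos S). Qed.

Lemma trajectory_continuous (a t : R) : 0 < a -> 0 < t -> (t%:E < T)%E ->
  {for t, continuous (X a)}.
Proof.
move=> a0 t0 tT; apply/differentiable_continuous/derivable1_diffP.
by have [] := sol_X_path S a0 t0 tT.
Qed.

Lemma gas_region_near (a t : R) : 0 < a -> 0 < t -> (t%:E < T)%E ->
  \forall p \near (X a t, t), gas_region T X p.
Proof.
apply: interior_gas_region; [exact: flow_lt|exact: gas_between|].
exact: trajectory_continuous.
Qed.

Lemma sol_field_mass (r t : R) : 0 < r -> 0 <= t -> (t%:E < T)%E ->
  dr phi r t = - mass (n^~ t) r.
Proof.
by move=> r0 t0 tT; have D := sol_field S r0 t0 tT; rewrite /dr derive1E derive_val.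
Qed.

Lemma is_derive_mass_gas (r t : R) : gas_region T X (r, t) ->
  is_derive r 1 (mass (n^~ t)) (n r t).
Proof.
move=> rt; have [/= t0 tT rgas] := rt.
have r0 : 0 < r := gas_gt0 t0 tT rgas.
have D := sol_poisson S rt.
apply: (@near_eq_is_derive _ _ _ (fun x => - dr phi x t)); last first.
  by rewrite -[n r t]opprK; exact: is_deriveN.
near=> x; rewrite sol_field_mass ?opprK//.
by near: x; exact: lt_nbhsr.
Unshelve. all: by end_near. Qed.

Lemma mass_sub_sol (r r' t : R) : 0 <= t -> (t%:E < T)%E -> 0 < r -> r < r' ->
  mass (n^~ t) r' - mass (n^~ t) r =
  \int[@lebesgue_measure R]_(x in `[r, r']) n x t.
Proof.
move=> t0 tT r0 rr'; apply: mass_sub => // x x0; exact: (sol_n_int S).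
Qed.

Lemma is_derive_mass_flow (a c t : R) : 0 < a -> 0 < c -> a != c -> 0 < t ->
  (t%:E < T)%E ->
  is_derive t 1 (fun s => mass (n^~ s) (X a s) - mass (n^~ s) (X c t))
    (n (X c t) t * u (X c t) t).
Proof.
move=> a0 c0 ac t0 tT.
pose f r s := mass (n^~ s) r - mass (n^~ s) (X c t).
have ga : gas X t (X a t) by exists a.
have gc : gas X t (X c t) by exists c.
have Xa0 : 0 < X a t by apply: (sol_X_pos S) => //; exact: ltW.
have Xc0 : 0 < X c t by apply: (sol_X_pos S) => //; exact: ltW.
have ft : is_derive t 1 (f (X a t)) (n (X c t) t * u (X c t) t - n (X a t) t * u (X a t) t).
  have [ltac|ltca|eqac] := ltgtP a c; last by rewrite eqac eqxx in ac.
    have XX : X a t < X c t by apply: flow_lt => //; exact: ltW.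
    have D := sol_mass S t0 tT ga gc XX.
    rewrite -opprB; apply: near_eq_is_derive (is_deriveN D).
    near=> s; rewrite fctE /f -opprB; congr (- _); apply/esym; apply: mass_sub_sol => //.
      by near: s; apply: filterS (lt_nbhsr t0) => ? /ltW.
    by near: s; apply: near_ltT.
  have XX : X c t < X a t by apply: flow_lt => //; exact: ltW.
  have D := sol_mass S t0 tT gc ga XX.
  apply: near_eq_is_derive D.
  near=> s; rewrite /f; apply/esym; apply: mass_sub_sol => //.
    by near: s; apply: filterS (lt_nbhsr t0) => ? /ltW.
  by near: s; apply: near_ltT.
have nearG := gas_region_near a0 t0 tT.
have -> : n (X c t) t * u (X c t) t = n (X a t) t * u (X a t) t +
    (n (X c t) t * u (X c t) t - n (X a t) t * u (X a t) t) by ring.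
apply: (@is_derive_along _ f n (X a)) => //.
- apply: filterS nearG => -[r s] rs /=.
  rewrite -[n r s]subr0; apply: is_deriveB; exact: is_derive_mass_gas.
- exact: within_near_continuous (sol_n_cont S) nearG.
- exact: (sol_X_path S).
Unshelve. all: by end_near. Qed.

Lemma mass_flow_sub_const (a b s t : R) : 0 < a -> 0 < b -> 0 < s -> 0 < t ->
  (s%:E < T)%E -> (t%:E < T)%E ->
  mass (n^~ s) (X b s) - mass (n^~ s) (X a s) =
  mass (n^~ t) (X b t) - mass (n^~ t) (X a t).
Proof.
move=> a0 b0 s0 t0 sT tT.
pose D r := mass (n^~ r) (X b r) - mass (n^~ r) (X a r).
have [|r [rst]] := @MVT_minmax _ D (cst 0) t s; last first.
  by rewrite mul0r => /eqP; rewrite subr_eq0 => /eqP.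
move=> r /andP[r1 r2].
have r0 : 0 < r by rewrite (lt_le_trans _ r1)// lt_min s0 t0.
have rT : (r%:E < T)%E.
  by move: r2; rewrite le_max => /orP[]; exact: ltT_le.
(* A third particle, distinct from both, supplies the common frozen point; its flux cancels in the
   difference. *)
pose c := a + b + 1.
have ac : a != c by rewrite lt_eqF// /c; lra.
have bc : b != c by rewrite lt_eqF// /c; lra.
have c0 : 0 < c by rewrite /c; lra.
have := is_deriveB (is_derive_mass_flow b0 c0 bc r0 rT) (is_derive_mass_flow a0 c0 ac r0 rT).
by rewrite subrr; apply: near_eq_is_derive; near=> x; rewrite /D !fctE; ring.
Unshelve. all: by end_near. Qed.

End lagrangian_solution.

Lemma derivable1_continuous (R : realType) (f : R -> R) (x : R) :
  derivable f x 1 -> {for x, continuous f}.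
Proof. by move=> df; apply/differentiable_continuous/derivable1_diffP. Qed.

Lemma MVT_cst (R : realType) (f : R -> R) (a b : R) : a <= b ->
  (forall x, a < x < b -> is_derive x 1 f 0) -> {within `[a, b], continuous f} ->
  f a = f b.
Proof.
move=> ab df cf.
have D x : x \in `]a, b[%R -> is_derive x 1 f (cst 0 x) by rewrite in_itv; exact: df.
have [x _ e] := MVT_segment ab D cf.
by apply/esym/eqP; rewrite -subr_eq0 e mul0r.
Qed.

Lemma dist_minmax (R : realType) (p q r x d : R) : `|p - x| < d -> `|q - x| < d ->
  Num.min p q <= r <= Num.max p q -> `|r - x| < d.
Proof.
rewrite ge_min le_max !ltr_norml.
by move=> /andP[? ?] /andP[? ?] /andP[/orP[?|?] /orP[?|?]]; apply/andP; split; lra.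
Qed.

Section initial_data.
Context (R : realType) (k : R) (n0 u0 : R -> R).

Definition speed (a t : R) : R := u0 a + k * mass n0 a * t.
Definition flow (a t : R) : R := a + u0 a * t + k * mass n0 a * t ^+ 2 / 2.
Definition jac (a t : R) : R := 1 + derive1 u0 a * t + k * n0 a * t ^+ 2 / 2.

Hypothesis hdata : admissible_data n0 u0.

Lemma is_derive_u0 (a : R) : 0 < a -> is_derive a 1 u0 (derive1 u0 a).
Proof.
by move=> a0; rewrite derive1E; apply/derivableP; exact: (data_u0_C1 hdata a0).1.
Qed.

Lemma n0_continuous (a : R) : 0 < a -> {for a, continuous n0}.
Proof.
by move=> a0; apply: derivable1_continuous; exact: (data_n0_C1 hdata a0).1.
Qed.

Lemma is_derive_mass0 (a : R) : 0 < a -> is_derive a 1 (mass n0) (n0 a).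
Proof.
move=> a0; apply: is_derive_mass => //; first exact: (data_n0_int hdata).
exact: n0_continuous.
Qed.

Lemma is_derive_speed_label (a t : R) : 0 < a ->
  is_derive a 1 (speed^~ t) (derive1 u0 a + k * n0 a * t).
Proof.
move=> a0; have Du := is_derive_u0 a0; have Dm := is_derive_mass0 a0.
by apply: is_derive_eq; rewrite /GRing.scale/=; ring.
Qed.

Lemma is_derive_flow_label (a t : R) : 0 < a ->
  is_derive a 1 (flow^~ t) (jac a t).
Proof.
move=> a0; have Du := is_derive_u0 a0; have Dm := is_derive_mass0 a0.
by apply: is_derive_eq; rewrite /GRing.scale/= /jac; ring.
Qed.

Lemma is_derive_flow_time (a t : R) : is_derive t 1 (flow a) (speed a t).
Proof. by apply: is_derive_eq; rewrite /GRing.scale/= /speed; field. Qed.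

Lemma is_derive_speed_time (a t : R) : is_derive t 1 (speed a) (k * mass n0 a).
Proof. by apply: is_derive_eq; rewrite /GRing.scale/=; ring. Qed.

End initial_data.

(** * The field is constant along particle paths *)

Section solution_is_lagrangian.
Context (R : realType) (k : R) (n0 u0 : R -> R) (T : \bar R)
  (n u phi X : R -> R -> R).
Hypothesis hdata : admissible_data n0 u0.
Hypothesis S : smooth_solution k n0 u0 T n u phi X.

(* The mass between two particles is the same at all times s in ]0, T[;
   letting s -> 0 pointwise identifies its derivative in the second label. *)
Lemma is_derive_mass_flow_label (b t : R) : 0 < b -> 0 < t -> (t%:E < T)%E ->
  is_derive b 1 (fun x => mass (n^~ t) (X x t)) (n0 b).
Proof.
move=> b0 t0 tT; apply/is_derive_normP => e e0.
have T0 : (0%:E < T)%E by apply: ltT_le tT _; exact: ltW.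
have Xb0 : X b 0 = b := sol_X_init S b0.
have gb : gas_region T X (b, 0) by split => //; exists b.
have [d d0 Hd] := (within_prod_normP _ _).1 (sol_n_cont S) _ _ gb _ e0.
rewrite /= (sol_n_init S)// in Hd.
have lb : label_region T (b, 0) by [].
have [d' d'0 Hd'] := (within_prod_normP _ _).1 (sol_X_cont S) _ _ lb _ d0.
rewrite /= Xb0 in Hd'.
exists (Num.min d' b); first by rewrite lt_min d'0.
move=> x; rewrite lt_min => /andP[xd xb].
have x0 : 0 < x by move: xb; rewrite ltr_norml => /andP[]; lra.
have lx : label_region T (x, 0) by [].
(* The radius around [b] depends on [e] only. For a fixed [x], the time s is then taken so small
   that each position is within [h'] of its label: the increment is off by at most [2 * h'], with a
   factor of at most [e + |n0 b|], and the slack [h] absorbs this. *)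
apply/ler_addgt0Pr => h h0.
have [h' h'0 A4] : exists2 h', 0 < h' & (e + `|n0 b| + 1) * (2 * h') = h.
  have c0 : 0 < e + `|n0 b| + 1 by have := normr_ge0 (n0 b); lra.
  exists (h / (e + `|n0 b| + 1) / 2); first by rewrite !divr_gt0.
  by field; rewrite gt_eqF.
have [c1 c10 H1] := (within_prod_normP _ _).1 (sol_X_cont S) _ _ lx _ h'0.
have [c2 c20 H2] := (within_prod_normP _ _).1 (sol_X_cont S) _ _ lb _ h'0.
rewrite /= (sol_X_init S)// in H1; rewrite /= Xb0 in H2.
have [s s0 [sc1 sc2 sd' sd st]] : exists2 s, 0 < s &
    [/\ s <= c1 / 2, s <= c2 / 2, s <= d' / 2, s <= d / 2 & s <= t].
  exists (Num.min (Num.min (c1 / 2) (c2 / 2))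
    (Num.min (Num.min (d' / 2) (d / 2)) t)); first by rewrite !lt_min !divr_gt0.
  by split; rewrite !ge_min !lexx ?orbT.
have sT : (s%:E < T)%E by exact: ltT_le tT st.
have sn c : s <= c / 2 -> `|s - 0| < c by move=> sc; rewrite subr0 gtr0_norm//; lra.
have lxs : label_region T (x, s) by split => //=; exact: ltW.
have lbs : label_region T (b, s) by split => //=; exact: ltW.
have {}H1 : `|X x s - x| < h' by apply: H1 => //; [rewrite subrr normr0|exact: sn].
have {}H2 : `|X b s - b| < h' by apply: H2 => //; [rewrite subrr normr0|exact: sn].
have -> : mass (n^~ t) (X x t) - mass (n^~ t) (X b t) =
    mass (n^~ s) (X x s) - mass (n^~ s) (X b s) by exact: (mass_flow_sub_const S).
have Xx : `|X x s - b| < d by apply: Hd' => //; exact: sn.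
have Xb : `|X b s - b| < d by apply: Hd' => //; [rewrite subrr normr0|exact: sn].
have between r : Num.min (X b s) (X x s) <= r <= Num.max (X b s) (X x s) ->
    gas_region T X (r, s) /\ `|r - b| < d.
  move=> rbx; split.
    split => //=; first exact: ltW.
    have [xltb|bltx|xeqb] := ltgtP x b.
    - have XX : X x s < X b s by apply: (flow_lt S) => //; exact: ltW.
      apply: (gas_between S x0 (ltW xltb) (ltW s0) sT).
      by move: rbx; rewrite (min_idPr (ltW XX)) (max_idPl (ltW XX)).
    - have XX : X b s < X x s by apply: (flow_lt S) => //; exact: ltW.
      apply: (gas_between S b0 (ltW bltx) (ltW s0) sT).
      by move: rbx; rewrite (min_idPl (ltW XX)) (max_idPr (ltW XX)).
    - by move: rbx; rewrite xeqb minxx maxxx => /le_anti <-; exists b.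
  exact: dist_minmax Xb Xx rbx.
have [|r [rbx ->]] := @MVT_minmax R (mass (n^~ s)) (n^~ s) (X b s) (X x s).
  by move=> r /between[rg _]; exact: (is_derive_mass_gas S).
have [rg rd] := between _ rbx.
have nr : `|n r s - n0 b| < e by apply: Hd => //; exact: sn.
have DX : `|(X x s - X b s) - (x - b)| <= 2 * h'.
  have -> : (X x s - X b s) - (x - b) = (X x s - x) - (X b s - b) by ring.
  by rewrite (le_trans (ler_normB _ _))//; lra.
have -> : n r s * (X x s - X b s) - n0 b * (x - b) =
  (n r s - n0 b) * (x - b) + (n r s - n0 b) * ((X x s - X b s) - (x - b)) +
  n0 b * ((X x s - X b s) - (x - b)) by ring.
rewrite (le_trans (ler_normD _ _))// normrM.
rewrite (le_trans (lerD (ler_normD _ _) (lexx _)))// !normrM.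
have A1 : `|n r s - n0 b| * `|x - b| <= e * `|x - b| by rewrite ler_wpM2r// ltW.
have A2 : `|n r s - n0 b| * `|X x s - X b s - (x - b)| <= e * (2 * h').
  by rewrite ler_pM// ltW.
have A3 : `|n0 b| * `|X x s - X b s - (x - b)| <= `|n0 b| * (2 * h') by rewrite ler_wpM2l.
clear - A1 A2 A3 A4 h'0.
lra.
Qed.

Lemma mass_flow_sub (a b t : R) : 0 < a -> 0 < b -> 0 < t -> (t%:E < T)%E ->
  mass (n^~ t) (X b t) - mass n0 b = mass (n^~ t) (X a t) - mass n0 a.
Proof.
move=> a0 b0 t0 tT.
pose f x := mass (n^~ t) (X x t) - mass n0 x.
have [|x [_]] := @MVT_minmax R f (cst 0) a b.
  move=> x /andP[x1 x2].
  have x0 : 0 < x by rewrite (lt_le_trans _ x1)// lt_min a0.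
  rewrite [cst 0 x](_ : _ = n0 x - n0 x); last by rewrite subrr.
  apply: is_deriveB; first exact: is_derive_mass_flow_label.
  exact: (is_derive_mass0 hdata x0).
by rewrite mul0r => /eqP; rewrite subr_eq0 => /eqP.
Qed.

(** The discrepancy is the same for all labels, so it is estimated at a label [c] close to 0. There
    [mass n0 c] is small by continuity at 0, and [X c t] is close to the infimum of the gas; the
    mass vanishes at that infimum because of the vacuum below, so it is small at [X c t]. *)
Lemma mass_flow (b t : R) : 0 < b -> 0 <= t -> (t%:E < T)%E ->
  mass (n^~ t) (X b t) = mass n0 b.
Proof.
move=> b0; rewrite le_eqVlt => /predU1P[<-{t}|t0] tT.
  by rewrite (sol_X_init S)//; apply: mass_ext => x /andP[x0 _]; exact: (sol_n_init S).
apply/eqP; rewrite -subr_eq0 -normr_le0; apply/ler_addgt0Pr => e e0; rewrite add0r.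
have e20 : 0 < e / 2 by lra.
have cn0 : {for 0, continuous (mass n0)} := continuous_mass (data_n0_int hdata) (x:=0).
have /cvgrPdist_lt/(_ _ e20)/nbhs_ballP[d0 /= d00 H0] := cn0.
have intn r : 0 < r -> (@lebesgue_measure R).-integrable `]0, r[ (EFin \o n^~ t).
  by move=> r0; apply: (sol_n_int S) => //; exact: ltW.
pose s := inf (gas X t).
have hi : has_inf (gas X t).
  split; first by exists (X 1 t), 1 => //=.
  by exists 0 => r rg; rewrite ltW// (gas_gt0 S (ltW t0) tT rg).
have ms : mass (n^~ t) s = 0.
  apply: mass_eq0 => x /andP[x0 xs]; apply: (sol_vacuum S) => //; first exact: ltW.
  by move=> xg; have := inf_lbound hi.2 xg; rewrite leNgt xs.
have cs : {for s, continuous (mass (n^~ t))} := continuous_mass intn (x:=s).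
have /cvgrPdist_lt/(_ _ e20)/nbhs_ballP[d /= dp H] := cs.
have [r [a a0 ar] rs] := inf_adherent dp hi.
pose c := Num.min a (d0 / 2).
have c0 : 0 < c by rewrite lt_min a0 divr_gt0.
rewrite (mass_flow_sub c0 b0 t0 tT) (le_trans (ler_normB _ _))//.
have -> : e = e / 2 + e / 2 by field.
apply: lerD.
  have := H (X c t); rewrite ms sub0r normrN => h; apply/ltW/h.
  have sX : s <= X c t by apply: (inf_lbound hi.2); exists c.
  have Xa : X c t <= X a t.
    have : c <= a by rewrite ge_min lexx.
    by rewrite le_eqVlt => /predU1P[->//|ca]; apply/ltW/(flow_lt S) => //; exact: ltW.
  by rewrite /ball /= ler0_norm ?subr_le0// opprB; move: rs; rewrite -ar /s; lra.
have := H0 c; rewrite (@mass_eq0 _ _ 0); last first.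
  by move=> x /andP[x0 x0']; have := lt_trans x0 x0'; rewrite ltxx.
rewrite sub0r normrN => h; apply/ltW/h; rewrite /ball /= sub0r normrN gtr0_norm//.
have : c <= d0 / 2 by rewrite ge_min lexx orbT.
lra.
Qed.

End solution_is_lagrangian.

(** * Explicit formulas satisfied by any smooth solution *)

Section solution_formulas.
Context (R : realType) (k : R) (n0 u0 : R -> R) (T : \bar R)
  (n u phi X : R -> R -> R).
Hypothesis hdata : admissible_data n0 u0.
Hypothesis S : smooth_solution k n0 u0 T n u phi X.

Lemma is_derive_velocity (a t : R) : 0 < a -> 0 < t -> (t%:E < T)%E ->
  is_derive t 1 (fun s => u (X a s) s) (k * mass n0 a).
Proof.
move=> a0 t0 tT.
have nearG := gas_region_near S a0 t0 tT.
have g := nbhs_singleton nearG.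
have Xa0 : 0 < X a t by apply: (sol_X_pos S) => //; exact: ltW.
have e : dr u (X a t) t * u (X a t) t + dt u (X a t) t = k * mass n0 a.
  rewrite mulrC addrC (sol_momentum S)// (sol_field_mass S)//; last exact: ltW.
  by rewrite mulrNN (mass_flow hdata S)// ltW.
rewrite -e; apply: (@is_derive_along _ u (dr u) (X a)).
- apply: filterS nearG => -[r s] rs /=.
  by rewrite /dr derive1E; apply/derivableP/(sol_u_der S).
- exact: within_near_continuous (sol_ur_cont S) nearG.
- exact: (sol_X_path S).
- by rewrite /dt derive1E; apply/derivableP/(sol_u_dert S).
Qed.

Lemma velocity_speed (a t : R) : 0 < a -> 0 <= t -> (t%:E < T)%E ->
  u (X a t) t = speed k n0 u0 a t.
Proof.
move=> a0 t0 tT; apply/eqP; rewrite -subr_eq0; apply/eqP.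
pose f s := u (X a s) s - speed k n0 u0 a s.
rewrite -[LHS]/(f t); have <- : f 0 = f t; last first.
  by rewrite /f /speed (sol_X_init S)// (sol_u_init S)// mulr0 addr0 subrr.
apply: MVT_cst => //.
  move=> s /andP[s0 st]; rewrite -(subrr (k * mass n0 a)).
  apply: is_deriveB; last exact: is_derive_speed_time.
  by apply: is_derive_velocity => //; apply: ltT_le tT _; exact: ltW.
(* The derivative is known at positive times only; continuity up to time 0 ties the identity to the
   initial data. *)
move=> s; apply: continuousB; last first.
  apply: continuous_subspaceT => r; apply: derivable1_continuous.
  by case: (is_derive_speed_time k n0 u0 a r).
move: s; apply/within_normP => s; rewrite /= in_itv/= => /andP[s0 st] e e0.
have sT := ltT_le tT st.
have [d d0 H] := (within_prod_normP _ _).1 (sol_u_cont S) _ _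
  (gas_regionX X a0 s0 sT) _ e0.
have Das : label_region T (a, s) by [].
have [d' d'0 H'] := (within_prod_normP _ _).1 (sol_X_cont S) _ _ Das _ d0.
exists (Num.min d d'); first by rewrite lt_min d0.
move=> r; rewrite lt_min in_itv/= => /andP[rd rd'] /andP[r0 rt].
have rT := ltT_le tT rt.
apply: H => //; last exact: gas_regionX.
by apply: H' => //; rewrite subrr normr0.
Qed.

Lemma trajectory_flow (a t : R) : 0 < a -> 0 <= t -> (t%:E < T)%E ->
  X a t = flow k n0 u0 a t.
Proof.
move=> a0 t0 tT; apply/eqP; rewrite -subr_eq0; apply/eqP.
pose f s := X a s - flow k n0 u0 a s.
rewrite -[LHS]/(f t); have <- : f 0 = f t; last first.
  by rewrite /f /flow (sol_X_init S)// expr0n /= !mulr0 mul0r !addr0 subrr.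
apply: MVT_cst => //.
  move=> s /andP[s0 st]; rewrite -(subrr (speed k n0 u0 a s)).
  have sT := ltT_le tT (ltW st).
  apply: is_deriveB; last exact: is_derive_flow_time.
  by rewrite -velocity_speed//; [exact: (sol_X_path S)|exact: ltW].
move=> s; apply: continuousB; first exact: (trajectory_within S a0 tT).
apply: continuous_subspaceT => r; apply: derivable1_continuous.
by case: (is_derive_flow_time k n0 u0 a r).
Qed.

(** Strict monotonicity of the flow would allow a zero of its derivative. The linear bound of
    [flow_increment] on [[a, a + 1]] gives, for a small step h, [c * h <= (jac + c / 2) * h]. *)
Lemma jac_gt0 (a t : R) : 0 < a -> 0 <= t -> (t%:E < T)%E ->
  0 < jac k n0 u0 a t.
Proof.
move=> a0 t0 tT.
have [|c c0 H] := @flow_increment _ _ _ _ _ _ _ _ _ S a (a + 1) t a0 _ t0 tT; first lra.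
have c20 : 0 < c / 2 by lra.
have /is_derive_normP/(_ _ c20)[d d0 Hd] := is_derive_flow_label k hdata t a0.
have [h h0 [hd h1]] : exists2 h, 0 < h & h < d /\ h <= 1.
  exists (Num.min (d / 2) 1); first by rewrite lt_min divr_gt0/=.
  by rewrite gt_min ge_min lexx orbT; split => //; apply/orP; left; lra.
have := H a (a + h) (lexx _); rewrite !trajectory_flow//; last lra.
rewrite addrAC subrr add0r => Hh.
have := Hd (a + h); rewrite addrAC subrr add0r gtr0_norm// => /(_ hd).
have {}Hh := Hh _ _; rewrite ler_norml => /andP[_ Hj].
have : c * h <= flow k n0 u0 (a + h) t - flow k n0 u0 a t by apply: Hh; lra.
move=> hc; have : 0 < (jac k n0 u0 a t) * h; last by rewrite pmulr_lgt0.
have : 0 < c / 2 * h by rewrite mulr_gt0.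
lra.
Qed.

(** Differentiate [u (flow b t) t = speed b t] in the label [b]. *)
Lemma velocity_gradient (a t : R) : 0 < a -> 0 <= t -> (t%:E < T)%E ->
  dr u (X a t) t * jac k n0 u0 a t = derive1 u0 a + k * n0 a * t.
Proof.
move=> a0 t0 tT.
have D : is_derive (flow k n0 u0 a t) 1 (u^~ t) (dr u (X a t) t).
  rewrite -trajectory_flow// /dr derive1E; apply/derivableP/(sol_u_der S).
  exact: gas_regionX.
have D1 := @is_derive1_comp R _ (fun b => flow k n0 u0 b t) a _ _ D
  (is_derive_flow_label k hdata t a0).
have D2 := is_derive_speed_label k hdata t a0.
rewrite -(@derive_val _ _ _ _ _ _ _ D1) -(@derive_val _ _ _ _ _ _ _ D2).
apply: near_eq_derive; near=> b.
have b0 : 0 < b by near: b; exact: lt_nbhsr.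
by rewrite /= -trajectory_flow// velocity_speed.
Unshelve. all: by end_near. Qed.

(** Differentiating the conserved mass in the label, instead of following [n] in time, involves no
    derivative of [n]. *)
Lemma density_jac (a t : R) : 0 < a -> 0 <= t -> (t%:E < T)%E ->
  n (X a t) t * jac k n0 u0 a t = n0 a.
Proof.
move=> a0 t0 tT.
have D : is_derive (flow k n0 u0 a t) 1 (mass (n^~ t)) (n (X a t) t).
  by rewrite -trajectory_flow//; apply: (is_derive_mass_gas S); exact: gas_regionX.
have D1 := @is_derive1_comp R _ (fun b => flow k n0 u0 b t) a _ _ D
  (is_derive_flow_label k hdata t a0).
have D2 := is_derive_mass0 hdata a0.
rewrite -(@derive_val _ _ _ _ _ _ _ D1) -(@derive_val _ _ _ _ _ _ _ D2).
apply: near_eq_derive; near=> b.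
have b0 : 0 < b by near: b; exact: lt_nbhsr.
by rewrite /= -trajectory_flow// (mass_flow hdata S).
Unshelve. all: by end_near. Qed.

End solution_formulas.

(** * Inverting the flow *)

Lemma within_pointwise (R : realType) (D : set (R * R)) (f : R * R -> R) :
  (forall p, D p -> {for p, continuous f}) -> {within D, continuous f}.
Proof.
move=> cf; apply/subspace_continuousP => p /cf; exact: cvg_within_filter.
Qed.

Lemma continuous_at_fst (R : realType) (f : R -> R) (p : R * R) :
  {for p.1, continuous f} -> {for p, continuous (fun p : R * R => f p.1)}.
Proof. by move=> cf; apply: continuous_comp cf; exact: cvg_fst. Qed.

Lemma continuous_at_snd (R : realType) (f : R -> R) (p : R * R) :
  {for p.2, continuous f} -> {for p, continuous (fun p : R * R => f p.2)}.
Proof. by move=> cf; apply: continuous_comp cf; exact: cvg_snd. Qed.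

Section lagrangian_flow.
Context (R : realType) (k : R) (n0 u0 : R -> R) (T : \bar R).
Hypothesis hk : 0 < k.
Hypothesis hdata : admissible_data n0 u0.
Hypothesis jac_pos : forall a t : R, 0 < a -> 0 <= t -> (t%:E < T)%E ->
  0 < jac k n0 u0 a t.

Local Notation F := (flow k n0 u0).
Local Notation J := (jac k n0 u0).
Local Notation W := (speed k n0 u0).
Local Notation G := (gas F).

Lemma mass0_ge0 (a : R) : 0 <= mass n0 a.
Proof.
apply: Rintegral_ge0 => x /=; rewrite in_itv/= => /andP[x0 _].
exact: (data_n0_ge0 hdata).
Qed.

Lemma flow_ge (a t : R) : 0 < a -> 0 <= t -> a <= F a t.
Proof.
move=> a0 t0; rewrite /flow -addrA lerDl addr_ge0//.
  by rewrite mulr_ge0// ltW// (data_u0_gt0 hdata).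
by rewrite divr_ge0// mulr_ge0 ?sqr_ge0// mulr_ge0 ?mass0_ge0// ltW.
Qed.

Lemma flow0 (a : R) : F a 0 = a.
Proof. by rewrite /flow expr0n/= !mulr0 mul0r !addr0. Qed.

Lemma flow_increasing (a b t : R) : 0 < a -> a < b -> 0 <= t -> (t%:E < T)%E ->
  F a t < F b t.
Proof.
move=> a0 ab t0 tT.
have [|x [/andP[x1 x2] e]] := @MVT_minmax R (fun x => F x t) (fun x => J x t) a b.
  move=> x /andP[x1 _]; apply: is_derive_flow_label => //.
  by rewrite (lt_le_trans _ x1)// lt_min a0; lra.
have x0 : 0 < x by rewrite (lt_le_trans _ x1)// lt_min a0; lra.
by rewrite -subr_gt0 e mulr_gt0 ?subr_gt0// jac_pos.
Qed.

Lemma flow_label_continuous (a t : R) : 0 < a -> {for a, continuous (fun a => F a t)}.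
Proof.
move=> a0; apply: derivable1_continuous.
by case: (is_derive_flow_label k hdata t a0).
Qed.

Lemma flow_time_continuous (a t : R) : {for t, continuous (F a)}.
Proof. by apply: derivable1_continuous; case: (is_derive_flow_time k n0 u0 a t). Qed.

Lemma gas_flow_between (a b t r : R) : 0 < a -> a <= b -> F a t <= r <= F b t ->
  G t r.
Proof.
move=> a0 ab /andP[ar rb].
have [||c] := @IVT R (fun x => F x t) a b r ab.
- apply: continuous_in_subspaceT => x; rewrite inE/= in_itv/= => /andP[ax _].
  by apply: flow_label_continuous; lra.
- by rewrite ge_min le_max ar rb orbT.
- by rewrite in_itv/= => /andP[ac cb] <-; exists c => //=; lra.
Qed.

(** The particle labelled [r] has moved to [r] or beyond, since velocities and field are
    nonnegative; so [r] lies between two particles. *)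
Lemma gas_flow_up (a t r : R) : 0 < a -> 0 <= t -> F a t <= r -> G t r.
Proof.
move=> a0 t0 ar; have ler : a <= r := le_trans (flow_ge a0 t0) ar.
by apply: (gas_flow_between a0 ler); rewrite ar flow_ge//; lra.
Qed.

Lemma gas_flow_gt0 (t r : R) : 0 <= t -> G t r -> 0 < r.
Proof. by move=> t0 [a a0 <-]; apply: lt_le_trans (flow_ge a0 t0). Qed.

(** Inverse of the flow in its first argument. Outside the gas it takes the value 0, which labels no
    particle. *)
Definition label (r t : R) : R := xget 0 [set a | 0 < a /\ F a t = r].

Lemma labelP (r t : R) : G t r -> 0 < label r t /\ F (label r t) t = r.
Proof.
move=> [a a0 ar]; apply: (@xgetPex _ 0 [set a | 0 < a /\ F a t = r]).
by exists a.
Qed.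

Lemma flow_inj (a b t : R) : 0 < a -> 0 < b -> 0 <= t -> (t%:E < T)%E ->
  F a t = F b t -> a = b.
Proof.
move=> a0 b0 t0 tT e; have [ab|ba|//] := ltgtP a b.
  by have := flow_increasing a0 ab t0 tT; rewrite e ltxx.
by have := flow_increasing b0 ba t0 tT; rewrite e ltxx.
Qed.

Lemma flowK (a t : R) : 0 < a -> 0 <= t -> (t%:E < T)%E -> label (F a t) t = a.
Proof.
move=> a0 t0 tT; have [|l0 e] := @labelP (F a t) t; first by exists a.
exact: flow_inj e.
Qed.

(** The particles [a - e'] and [a + e'] enclose [r] at time [t], hence nearby points at nearby
    times, and monotonicity in the label confines the labels of those points. The argument includes
    t = 0, a boundary time of the region. *)
Lemma label_within :
  {within gas_region T F, continuous (fun p : R * R => label p.1 p.2)}.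
Proof.
apply/within_prod_normP => r t [/= t0 tT rg] e e0.
have [a0 Fa] := labelP rg; set a := label r t in a0 Fa *.
(* The bound [a / 2] keeps the label [a - e'] positive. *)
pose e' := Num.min e (a / 2).
have e'0 : 0 < e' by rewrite lt_min e0 divr_gt0.
have e'e : e' <= e by rewrite ge_min lexx.
have e'a : e' <= a / 2 by rewrite ge_min lexx orbT.
have lo : F (a - e') t < r by rewrite -Fa; apply: flow_increasing => //; lra.
have hi : r < F (a + e') t by rewrite -Fa; apply: flow_increasing => //; lra.
pose h := Num.min ((r - F (a - e') t) / 2) ((F (a + e') t - r) / 2).
have h0 : 0 < h by rewrite lt_min !divr_gt0 ?subr_gt0.
have h1 : h <= (r - F (a - e') t) / 2 by rewrite ge_min lexx.
have h2 : h <= (F (a + e') t - r) / 2 by rewrite ge_min lexx orbT.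
clearbody e' h.
have /cvgrPdist_lt/(_ h h0) near_lo := @flow_time_continuous (a - e') t.
have /cvgrPdist_lt/(_ h h0) near_hi := @flow_time_continuous (a + e') t.
have [d /= d0 Hd] : \forall s \near t, `|F (a - e') t - F (a - e') s| < h /\
    `|F (a + e') t - F (a + e') s| < h.
  by apply: filterS2 near_lo near_hi => s.
exists (Num.min d h); first by rewrite lt_min d0.
move=> y s; rewrite !lt_min => /andP[_ yh] /andP[sd _] [/= s0 sT yg].
have [|lo' hi'] := Hd s; first by rewrite /= distrC.
have [b0 Fb] := labelP yg; set b := label y s in b0 Fb *.
have /andP[lo2 hi2] : F (a - e') s < y < F (a + e') s.
  exact: (between_perturb yh lo' hi' h1 h2).
rewrite (lt_le_trans _ e'e)// ltr_norml; apply/andP; split.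
  rewrite ltrBrDl ltNge; apply/negP; rewrite le_eqVlt => /predU1P[ba|ba].
    by move: lo2; rewrite -Fb ba ltxx.
  have := flow_increasing b0 ba s0 sT; rewrite Fb => /(lt_trans lo2).
  by rewrite ltxx.
rewrite ltrBlDl ltNge; apply/negP; rewrite le_eqVlt => /predU1P[ba|ba].
  by move: hi2; rewrite -Fb -ba ltxx.
have ae0 : 0 < a + e' by rewrite addr_gt0.
have := flow_increasing ae0 ba s0 sT; rewrite Fb => /(lt_trans hi2).
by rewrite ltxx.
Qed.

Lemma gas_flow_region_near (a t : R) : 0 < a -> 0 < t -> (t%:E < T)%E ->
  \forall p \near (F a t, t), gas_region T F p.
Proof.
apply: interior_gas_region.
- exact: flow_increasing.
- by move=> b c s r b0 bc _ _; exact: gas_flow_between.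
- by move=> b s _ _ _; exact: flow_time_continuous.
Qed.

Lemma label_comp_within (g : R -> R -> R) :
  (forall a t : R, 0 < a -> 0 <= t -> (t%:E < T)%E ->
    {for (a, t), continuous (fun p : R * R => g p.1 p.2)}) ->
  {within gas_region T F, continuous (fun p : R * R => g (label p.1 p.2) p.2)}.
Proof.
move=> cg; apply/subspace_continuousP => -[r t] rt.
have [/= t0 tT rg] := rt; have [a0 _] := labelP rg.
have /subspace_continuousP/(_ _ rt) cl := label_within.
apply: continuous2_cvg; [by apply: cg|exact: cl|].
by apply: cvg_within_filter; exact: cvg_snd.
Qed.

Lemma gas_near_space (r t : R) : 0 <= t -> (t%:E < T)%E -> G t r ->
  \forall x \near r, G t x.
Proof.
move=> t0 tT [a /= a0 <-]; have a20 : 0 < a / 2 by lra.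
have lo : F (a / 2) t < F a t by apply: flow_increasing => //; lra.
by apply: filterS (lt_nbhsr lo) => x /ltW; exact: gas_flow_up.
Qed.

Lemma is_derive_label_space (r t : R) : gas_region T F (r, t) ->
  is_derive r 1 (fun x => label x t) (J (label r t) t)^-1.
Proof.
move=> [/= t0 tT rg]; have [a0 Fa] := labelP rg; set a := label r t in a0 Fa *.
rewrite -Fa; apply: (@is_derive_inverse R (fun x => F x t)).
- by apply: filterS (lt_nbhsr a0) => b b0; exact: flowK.
- by apply: filterS (lt_nbhsr a0) => b b0; exact: flow_label_continuous.
- exact: is_derive_flow_label.
- by rewrite gt_eqF// jac_pos.
Qed.

Lemma jac_continuous (a t : R) : 0 < a ->
  {for (a, t), continuous (fun p : R * R => J p.1 p.2)}.
Proof.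
move=> a0; apply: continuousD.
  apply: continuousD; first exact: cvg_cst.
  apply: continuousM; last exact: cvg_snd.
  by apply: (@continuous_at_fst _ (derive1 u0)); exact: (data_u0_C1 hdata a0).2.
apply: continuousM; last exact: cvg_cst.
apply: continuousM.
  apply: continuousM; first exact: cvg_cst.
  by apply: (@continuous_at_fst _ n0); apply: (n0_continuous hdata).
by apply: (@continuous_at_snd _ (fun t => t ^+ 2)); exact: exprn_continuous.
Qed.

Lemma speed_continuous (a t : R) : 0 < a ->
  {for (a, t), continuous (fun p : R * R => W p.1 p.2)}.
Proof.
move=> a0; apply: continuousD.
  apply: (@continuous_at_fst _ u0); apply: derivable1_continuous.
  by case: (is_derive_u0 hdata a0).
apply: continuousM; last exact: cvg_snd.
apply: continuousM; first exact: cvg_cst.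
by apply: (@continuous_at_fst _ (mass n0)); apply: continuous_mass; exact: (data_n0_int hdata).
Qed.

(** The time derivative of [jac], equal to the label derivative of [speed]; [u_r] is
    [stretch / jac]. *)
Definition stretch (a t : R) : R := derive1 u0 a + k * n0 a * t.

Lemma stretch_continuous (a t : R) : 0 < a ->
  {for (a, t), continuous (fun p : R * R => stretch p.1 p.2)}.
Proof.
move=> a0; apply: continuousD.
  by apply: (@continuous_at_fst _ (derive1 u0)); exact: (data_u0_C1 hdata a0).2.
apply: continuousM; last exact: cvg_snd.
apply: continuousM; first exact: cvg_cst.
by apply: (@continuous_at_fst _ n0); apply: (n0_continuous hdata).
Qed.

Lemma flow_within_label :
  {within label_region T, continuous (fun p : R * R => F p.1 p.2)}.
Proof.
apply: within_pointwise => -[a t] [/= a0 _ _]; apply: continuousD.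
  apply: continuousD; first exact: cvg_fst.
  apply: continuousM; last exact: cvg_snd.
  apply: (@continuous_at_fst _ u0); apply: derivable1_continuous.
  by case: (is_derive_u0 hdata a0).
apply: continuousM; last exact: cvg_cst.
apply: continuousM; last first.
  by apply: (@continuous_at_snd _ (fun t => t ^+ 2)); exact: exprn_continuous.
apply: continuousM; first exact: cvg_cst.
by apply: (@continuous_at_fst _ (mass n0)); apply: continuous_mass; exact: (data_n0_int hdata).
Qed.

Lemma label_time_continuous (r t : R) : 0 < t -> gas_region T F (r, t) ->
  {for t, continuous (label r)}.
Proof.
move=> t0 [/= _ tT rg]; have [a0 Fa] := labelP rg.
have nearG := gas_flow_region_near a0 t0 tT; rewrite Fa in nearG.
have c := within_near_continuous label_within nearG.
apply: continuous2_cvg; [exact: c|exact: cvg_cst|exact: cvg_id].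
Qed.

(** Implicit differentiation of [F (label r s) s = r], an identity that persists for s near t
    because [r] stays in the gas. *)
Lemma is_derive_label_time (r t : R) : 0 < t -> gas_region T F (r, t) ->
  is_derive t 1 (label r) (- W (label r t) t / J (label r t) t).
Proof.
move=> t0 rt; have [/= _ tT rg] := rt; have [a0 Fa] := labelP rg.
apply: (@is_derive_implicit R F J).
- by apply/near_prodP; exists (label r t) => // b s; rewrite ltr_norml => /andP[bl _] _;
    apply: is_derive_flow_label => //=; lra.
- exact: jac_continuous.
- exact: label_time_continuous.
- exact: is_derive_flow_time.
- by rewrite gt_eqF// jac_pos// ltW.
- have := gas_flow_region_near a0 t0 tT; rewrite Fa => /near_prodP[d d0 Hd].
  near=> s; have [||_ _ sg] := Hd r s; last by have [_ ->] := labelP sg.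
    by rewrite subrr normr0.
  by rewrite distrC; near: s; exact: nbhsx_ballx.
Unshelve. all: by end_near. Qed.

End lagrangian_flow.

(** * The constructed density and its mass *)

Section density.
Context (R : realType) (k : R) (n0 u0 : R -> R) (T : \bar R).
Hypothesis hk : 0 < k.
Hypothesis hdata : admissible_data n0 u0.
Hypothesis jac_pos : forall a t : R, 0 < a -> 0 <= t -> (t%:E < T)%E ->
  0 < jac k n0 u0 a t.

Local Notation F := (flow k n0 u0).
Local Notation J := (jac k n0 u0).
Local Notation G := (gas F).
Local Notation A := (label k n0 u0).

Definition density (r t : R) : R :=
  if `[< G t r >] then n0 (A r t) / J (A r t) t else 0.

Lemma densityE (r t : R) : G t r -> density r t = n0 (A r t) / J (A r t) t.
Proof. by move=> rg; rewrite /density asboolT. Qed.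

Lemma density0 (r t : R) : ~ G t r -> density r t = 0.
Proof. by move=> rg; rewrite /density asboolF. Qed.

Lemma density_ge0 (r t : R) : 0 <= t -> (t%:E < T)%E -> 0 <= density r t.
Proof.
move=> t0 tT; rewrite /density; case: asboolP => // rg; have [a0 _] := labelP rg.
by rewrite divr_ge0 ?(data_n0_ge0 hdata)// ltW// jac_pos.
Qed.

Lemma density_continuous (r t : R) : gas_region T F (r, t) ->
  {for r, continuous (density^~ t)}.
Proof.
move=> rt; have [/= t0 tT rg] := rt; have [a0 _] := labelP rg.
have cA : {for r, continuous (fun x => A x t)}.
  apply: derivable1_continuous.
  by case: (is_derive_label_space hdata jac_pos rt).
have c : {for r, continuous (fun x => n0 (A x t) / J (A x t) t)}.
  apply: continuousM.
    by apply: (continuous_comp cA); exact: (n0_continuous hdata a0).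
  apply: continuousV; first by rewrite gt_eqF// jac_pos.
  by apply: continuous2_cvg (jac_continuous hdata a0) cA (cvg_cst _).
move: c; rewrite /prop_for /continuous_at densityE//; apply: cvg_trans.
apply: near_eq_cvg.
by apply: filterS (gas_near_space hk hdata jac_pos t0 tT rg) => x /densityE.
Qed.

(** Exhibits an antiderivative of the density on the gas, to be fed to the fundamental theorem of
    calculus. *)
Lemma is_derive_mass0_label (r t : R) : gas_region T F (r, t) ->
  is_derive r 1 (fun x => mass n0 (A x t)) (density r t).
Proof.
move=> rt; have [/= t0 tT rg] := rt; have [a0 _] := labelP rg; rewrite densityE//.
apply: (@is_derive1_comp R (mass n0) (fun x => A x t)).
  exact: (is_derive_mass0 hdata a0).
exact: (is_derive_label_space hdata jac_pos rt).
Qed.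

Lemma measurable_density (t : R) : 0 <= t -> (t%:E < T)%E ->
  measurable_fun setT (density^~ t).
Proof.
move=> t0 tT.
have oG : open (G t).
  by rewrite openE => r rg; exact: (gas_near_space hk hdata jac_pos t0 tT rg).
have -> : density^~ t = (density^~ t) \_ (G t).
  apply/funext => r; rewrite patchE; case: ifPn => //.
  by rewrite notin_setE => /density0.
have cG : {in G t, continuous (density^~ t)}.
  by move=> r; rewrite inE => rg; apply: density_continuous; split.
have := open_continuous_measurable_fun oG cG.
by move/(measurable_restrictT _ (open_measurable oG)).
Qed.

Lemma integral_density (a c t : R) : 0 < c -> c < a -> 0 <= t -> (t%:E < T)%E ->
  (\int[@lebesgue_measure R]_(x in `[F c t, F a t[) (density x t)%:E =
  (mass n0 a - mass n0 c)%:E)%E.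
Proof.
move=> c0 ca t0 tT; have a0 : 0 < a by lra.
have Fca : F c t < F a t by exact: (flow_increasing hdata jac_pos c0 ca t0 tT).
have reg x : F c t <= x -> gas_region T F (x, t).
  by move=> cx; split => //=; exact: (gas_flow_up hk hdata c0 t0 cx).
rewrite integral_itv_bndo_bndc; last first.
  apply/measurable_EFinP; apply: measurable_funS (measurable_density t0 tT) => //.
pose H x := mass n0 (A x t).
have cH x : F c t <= x -> {for x, continuous H}.
  by move=> /reg/is_derive_mass0_label[D _]; exact: derivable1_continuous.
rewrite (@continuous_FTC2 R (density^~ t) H)//.
- by rewrite /H !(flowK hdata jac_pos).
- apply: continuous_in_subspaceT => x; rewrite inE/= in_itv/= => /andP[cx _].
  exact: (density_continuous (reg _ cx)).
- split; first by move=> x; rewrite in_itv/= => /andP[/ltW/reg/is_derive_mass0_label[]].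
    by apply: cvg_at_right_filter; apply: cH.
  by apply: cvg_at_left_filter; apply: cH; exact: ltW.
- move=> x; rewrite in_itv/= => /andP[/ltW/reg/is_derive_mass0_label D _].
  by rewrite derive1E derive_val.
Qed.

(** The density is not controlled at the lower edge of the gas. The gas below [F a t] is therefore
    exhausted from the particles [c i = 1 / (i + 1)], with monotone convergence on one side and
    [mass n0 (c i)] tending to 0 on the other; the vacuum contributes nothing. *)
Lemma integral_density_gas (a t : R) : 0 < a -> 0 <= t -> (t%:E < T)%E ->
  (\int[@lebesgue_measure R]_(x in `]0%R, F a t[) (density x t)%:E =
  (mass n0 a)%:E)%E.
Proof.
move=> a0 t0 tT.
pose c i : R := i.+1%:R^-1.
have c0 i : 0 < c i by rewrite invr_gt0 ltr0n.
pose B i : set R := [set` `[F (c i) t, F a t[].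
have BG : \bigcup_i B i = `]0, F a t[ `&` G t.
  apply/seteqP; split => x.
    move=> [i _] /=; rewrite /B /= !in_itv/= => /andP[cx xa].
    have xg : G t x by exact: (gas_flow_up hk hdata (c0 i) t0 cx).
    by split => //; rewrite xa andbT; exact: (gas_flow_gt0 hk hdata t0 xg).
  rewrite /= in_itv/= => -[/andP[x0 xa] [b b0 bx]].
  have /cvgrPdist_lt/(_ _ b0)[i _ Hi] := @cvg_harmonic R.
  have cb : c i < b.
    have := Hi i (leqnn i); rewrite /= sub0r normrN gtr0_norm//; exact: c0.
  exists i => //; rewrite /B /= in_itv/= xa andbT -bx ltW//.
  exact: (flow_increasing hdata jac_pos (c0 i) cb t0 tT).
have mB i : measurable (B i) by exact: measurable_itv.
have mD D : measurable_fun D (fun x => (density x t)%:E).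
  by apply/measurable_EFinP; apply: measurable_funS (measurable_density t0 tT).
have -> : (\int[@lebesgue_measure R]_(x in `]0%R, F a t[) (density x t)%:E =
    \int[@lebesgue_measure R]_(x in \bigcup_i B i) (density x t)%:E)%E.
  rewrite BG integral_mkcondr; apply: eq_integral => x _; rewrite patchE.
  by case: ifPn => //; rewrite notin_setE => /density0 ->.
have ndB : {homo B : n m / (n <= m)%N >-> (n <= m)%O}.
  move=> i j ij; rewrite subsetEset; apply: subset_itvr; rewrite bnd_simp.
  have : c j <= c i by rewrite lef_pV2 ?posrE ?ltr0n// ler_nat.
  rewrite [c j <= _]le_eqVlt => /predU1P[->//|cc]; apply/ltW.
  exact: (flow_increasing hdata jac_pos (c0 j) cc t0 tT).
have cvgI : (\int[@lebesgue_measure R]_(x in B i) (density x t)%:E)%E @[i --> \oo] -->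
    (\int[@lebesgue_measure R]_(x in \bigcup_i B i) (density x t)%:E)%E.
  apply: (@ge0_nondecreasing_set_cvg_integral _ (measurableTypeR R) R B).
  - exact: ndB.
  - exact: mB.
  - by move=> i; exact: mD.
  - by move=> i x _; rewrite lee_fin density_ge0.
apply: (cvg_unique _ cvgI); first exact: ereal_hausdorff.
have : (mass n0 a - mass n0 (c i))%:E @[i --> \oo] --> (mass n0 a - mass n0 0)%:E.
  apply: cvg_EFin; first by near=> i.
  apply: cvgB; first exact: cvg_cst.
  apply: continuous_cvg; last exact: cvg_harmonic.
  exact: (continuous_mass (data_n0_int hdata)).
rewrite [mass n0 0]mass_eq0 ?subr0; last first.
  by move=> x /andP[x0 x1]; have := lt_trans x0 x1; rewrite ltxx.
rewrite /=; apply: cvg_trans; apply: near_eq_cvg.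
have /cvgrPdist_lt/(_ _ a0) := @cvg_harmonic R; apply: filterS => i.
rewrite sub0r normrN gtr0_norm ?invr_gt0 ?ltr0n//.
by move=> ca; rewrite integral_density.
Unshelve. all: by end_near. Qed.

End density.

(** * The constructed fields solve the equations *)

Section constructed_solution.
Context (R : realType) (k : R) (n0 u0 : R -> R) (T : \bar R).
Hypothesis hk : 0 < k.
Hypothesis hdata : admissible_data n0 u0.
Hypothesis jac_pos : forall a t : R, 0 < a -> 0 <= t -> (t%:E < T)%E ->
  0 < jac k n0 u0 a t.

Local Notation F := (flow k n0 u0).
Local Notation J := (jac k n0 u0).
Local Notation W := (speed k n0 u0).
Local Notation G := (gas F).
Local Notation A := (label k n0 u0).
Local Notation N := (density k n0 u0).

(** The point [r] may lie in the vacuum, but [r <= F r t], and []0, F r t[] carries the finite mass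
    [mass n0 r]. *)
Lemma integrable_density (r t : R) : 0 < r -> 0 <= t -> (t%:E < T)%E ->
  (@lebesgue_measure R).-integrable `]0, r[ (EFin \o N^~ t).
Proof.
move=> r0 t0 tT.
have mD D : measurable_fun D (EFin \o N^~ t).
  apply/measurable_EFinP.
  exact: measurable_funS (measurable_density hk hdata jac_pos t0 tT).
have I : (@lebesgue_measure R).-integrable `]0, F r t[ (EFin \o N^~ t).
  apply/integrableP; split; first exact: mD.
  rewrite (_ : (\int[_]_(x in _) _ = (mass n0 r)%:E)%E) ?ltry//.
  rewrite -(integral_density_gas hk hdata jac_pos r0 t0 tT).
  by apply: eq_integral => x _ /=; rewrite ger0_norm//; exact: (density_ge0 hdata jac_pos).
apply: integrableS I => //.
by apply: subset_itvl; rewrite bnd_simp (flow_ge hk hdata).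
Qed.

Lemma mass_density (r t : R) : gas_region T F (r, t) ->
  mass (N^~ t) r = mass n0 (A r t).
Proof.
move=> [/= t0 tT rg]; have [a0 {1}<-] := labelP rg.
by rewrite /mass /Rintegral (integral_density_gas hk hdata jac_pos).
Qed.

Definition velocity (r t : R) : R := W (A r t) t.
(** The inner [mass] is the field E; the outer one merely integrates it from 0, as [E = - phi_r]. *)
Definition potential (r t : R) : R := - mass (mass (N^~ t)) r.

Lemma is_derive_velocity_space (r t : R) : gas_region T F (r, t) ->
  is_derive r 1 (velocity^~ t) (stretch k n0 u0 (A r t) t / J (A r t) t).
Proof.
move=> rt; have [/= t0 tT rg] := rt; have [a0 _] := labelP rg.
apply: (@is_derive1_comp R (fun a => W a t) (fun x => A x t)).
  exact: (is_derive_speed_label k hdata t a0).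
exact: (is_derive_label_space hdata jac_pos rt).
Qed.

Lemma is_derive_velocity_time (r t : R) : 0 < t -> gas_region T F (r, t) ->
  is_derive t 1 (velocity r) (stretch k n0 u0 (A r t) t *
    (- W (A r t) t / J (A r t) t) + k * mass n0 (A r t)).
Proof.
move=> t0 rt; have [/= _ tT rg] := rt; have [a0 _] := labelP rg.
apply: (@is_derive_along R W (stretch k n0 u0) (A r)).
- apply/near_prodP; exists (A r t) => // b s; rewrite ltr_norml => /andP[bl _] _.
  by apply: (is_derive_speed_label k hdata) => /=; lra.
- exact: stretch_continuous.
- exact: (is_derive_label_time hdata jac_pos).
- exact: is_derive_speed_time.
Qed.

Lemma gas_near_time (r t : R) : 0 < t -> gas_region T F (r, t) ->
  \forall s \near t, gas_region T F (r, s).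
Proof.
move=> t0 [/= _ tT rg]; have [a0 Fa] := labelP rg.
have := gas_flow_region_near hdata jac_pos a0 t0 tT.
rewrite Fa => /near_prodP[d d0 Hd]; near=> s; apply: Hd; first by rewrite subrr normr0.
by rewrite distrC; near: s; exact: nbhsx_ballx.
Unshelve. all: by end_near. Qed.

Lemma is_derive_potential (r t : R) : 0 < r -> 0 <= t -> (t%:E < T)%E ->
  is_derive r 1 (potential^~ t) (- mass (N^~ t) r).
Proof.
move=> r0 t0 tT; apply: is_deriveN.
have cm : continuous (mass (N^~ t)).
  by apply: continuous_mass => x x0; exact: integrable_density.
apply: is_derive_mass => //; last exact: cm.
move=> x x0.
have I : (@lebesgue_measure R).-integrable `[0, x] (EFin \o mass (N^~ t)).
  apply: continuous_compact_integrable; first exact: segment_compact.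
  exact: continuous_subspaceT.
by apply: integrableS I => //; exact: subset_itv_oo_cc.
Qed.

Lemma constructed_solution :
  smooth_solution k n0 u0 T N velocity potential F.
Proof.
have A0 r : 0 < r -> A r 0 = r.
  by move=> r0; have [|_] := @labelP R k n0 u0 r 0; [exists r => //|]; rewrite flow0.
have J0 a t : 0 < a -> 0 <= t -> (t%:E < T)%E -> J a t != 0.
  by move=> a0 t0 tT; rewrite gt_eqF// jac_pos.
have cS a t : 0 < a -> 0 <= t -> (t%:E < T)%E ->
    {for (a, t), continuous (fun p : R * R => stretch k n0 u0 p.1 p.2 / J p.1 p.2)}.
  move=> a0 t0 tT; apply: continuousM; first exact: stretch_continuous.
  by apply: continuousV; [exact: J0|exact: jac_continuous].
have cn0 a t : 0 < a -> {for (a, t), continuous (fun p : R * R => n0 p.1)}.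
  by move=> a0; apply: (@continuous_at_fst _ n0); exact: (n0_continuous hdata).
have drE r t : gas_region T F (r, t) ->
    dr velocity r t = stretch k n0 u0 (A r t) t / J (A r t) t.
  by move=> /is_derive_velocity_space D; rewrite /dr derive1E derive_val.
have dtE r t : 0 < t -> gas_region T F (r, t) -> dt velocity r t =
    stretch k n0 u0 (A r t) t * (- W (A r t) t / J (A r t) t) + k * mass n0 (A r t).
  move=> t0 rt; have D := is_derive_velocity_time t0 rt.
  by rewrite /dt derive1E derive_val.
have dphi r t : 0 < r -> 0 <= t -> (t%:E < T)%E -> dr potential r t = - mass (N^~ t) r.
  move=> r0 t0 tT; have D := is_derive_potential r0 t0 tT.
  by rewrite /dr derive1E derive_val.
split.
- move=> r r0; rewrite densityE; last by exists r => //; exact: flow0.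
  by rewrite A0// /jac expr0n/= !mulr0 mul0r !addr0 divr1.
- by move=> r r0; rewrite /velocity A0// /speed mulr0 addr0.
- by move=> a _; exact: flow0.
- by move=> a t a0 t0 _; exact: lt_le_trans (flow_ge hk hdata a0 t0).
- exact: flow_within_label.
- move=> a t a0 t0 tT; rewrite /velocity (flowK hdata jac_pos)//; last exact: ltW.
  exact: is_derive_flow_time.
- apply: (@subspace_eq_continuous _ _ _ (fun p : R * R => n0 (A p.1 p.2) / J (A p.1 p.2) p.2)).
    by move=> [r t]; rewrite inE => -[_ _ rg]; rewrite /from_subspace/= densityE.
  have c := label_comp_within hdata jac_pos (g := fun a t => n0 a / J a t).
  apply: c => a t a0 t0 tT; apply: continuousM; first exact: cn0.
  by apply: continuousV; [exact: J0|exact: jac_continuous].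
- have c := label_comp_within hdata jac_pos (g := W).
  by apply: c => a t a0 _ _; exact: speed_continuous.
- by move=> r t /is_derive_velocity_space[].
- apply: (@subspace_eq_continuous _ _ _
      (fun p : R * R => stretch k n0 u0 (A p.1 p.2) p.2 / J (A p.1 p.2) p.2)).
    by move=> [r t]; rewrite inE => rt; rewrite /from_subspace/= drE.
  have c := label_comp_within hdata jac_pos (g := fun a t => stretch k n0 u0 a t / J a t).
  by apply: c.
- by move=> r t t0 rt; case: (is_derive_velocity_time t0 rt).
- apply: (@subspace_eq_continuous _ _ _
      (fun p : R * R => stretch k n0 u0 (A p.1 p.2) p.2 *
        (- W (A p.1 p.2) p.2 / J (A p.1 p.2) p.2) + k * mass n0 (A p.1 p.2))).
    by move=> [r t]; rewrite inE => -[rt /= t0]; rewrite /from_subspace/= dtE.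
  apply: continuous_subspaceW; first exact: subIsetl.
  have c := label_comp_within hdata jac_pos
    (g := fun a t => stretch k n0 u0 a t * (- W a t / J a t) + k * mass n0 a).
  apply: c => a t a0 t0 tT; apply: continuousD.
    apply: continuousM; first exact: stretch_continuous.
    apply: continuousM; first by apply: continuousN; exact: speed_continuous.
    by apply: continuousV; [exact: J0|exact: jac_continuous].
  apply: continuousM; first exact: cvg_cst.
  apply: (@continuous_at_fst _ (mass n0)); apply: continuous_mass.
  exact: (data_n0_int hdata).
- by move=> r t _ _ _; exact: density0.
- move=> a b t t0 tT ag bg ab.
  have at_ : gas_region T F (a, t) by split => //=; exact: ltW.
  have bt : gas_region T F (b, t) by split => //=; exact: ltW.
  have a0 := gas_flow_gt0 hk hdata (ltW t0) ag.
  have [la0 _] := labelP ag; have [lb0 _] := labelP bg.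
  (* At nearby times both fixed endpoints are still in the gas, and the mass between them is a
     difference of initial masses at their labels. As the label moves at rate [- W / J], each term
     differentiates to minus the flux [n * u]. *)
  apply: (@near_eq_is_derive _ _ _ (fun s => mass n0 (A b s) - mass n0 (A a s))).
    near=> s.
    have as_ : gas_region T F (a, s) by near: s; exact: gas_near_time.
    have bs : gas_region T F (b, s) by near: s; exact: gas_near_time.
    have [/= s0 sT _] := as_.
    by rewrite -!mass_density// mass_sub// => r r0; exact: integrable_density.
  have Db := @is_derive1_comp R (mass n0) (A b) t _ _ (is_derive_mass0 hdata lb0)
    (is_derive_label_time hdata jac_pos t0 bt).
  have Da := @is_derive1_comp R (mass n0) (A a) t _ _ (is_derive_mass0 hdata la0)
    (is_derive_label_time hdata jac_pos t0 at_).
  apply: (is_derive_eq (is_deriveB Db Da)).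
  by rewrite /velocity !densityE//; ring.
- move=> r t t0 rt; have [/= _ tT rg] := rt.
  rewrite drE// dtE// dphi ?(gas_flow_gt0 hk hdata _ rg) ?ltW// mass_density//.
  by rewrite /velocity; ring.
- move=> r t rt; have [/= t0 tT rg] := rt.
  apply: (@near_eq_is_derive _ _ _ (fun x => - mass n0 (A x t))).
    have nearG := gas_near_space hk hdata jac_pos t0 tT rg.
    near=> x; have xg : G t x by near: x.
    by rewrite dphi ?mass_density// (gas_flow_gt0 hk hdata t0 xg).
  by apply: is_deriveN; exact: (is_derive_mass0_label hdata jac_pos).
- exact: integrable_density.
- exact: is_derive_potential.
Unshelve. all: by end_near. Qed.

End constructed_solution.

(** * Breakdown time *)

Section breakdown.
Context (R : realType) (k : R) (n0 u0 : R -> R).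
Hypothesis hk : 0 < k.
Hypothesis hdata : admissible_data n0 u0.

Local Notation J := (jac k n0 u0).
Local Notation rt := (rate k n0 u0).
Local Notation crit := (critical k n0 u0).

(** For [p >= 0] no term of [J] is negative. For [p < 0], failure of criticality means that the
    quadratic has negative discriminant, and completing the square concludes. *)
Lemma jac_noncritical (a t : R) : 0 < a -> ~ crit a -> 0 <= t -> 0 < J a t.
Proof.
move=> a0 ncrit t0; rewrite /jac.
set p := derive1 u0 a; set q := k * n0 a.
have q0 : 0 <= q by rewrite mulr_ge0 ?(data_n0_ge0 hdata)// ltW.
have qt0 : 0 <= q * t ^+ 2 / 2 by rewrite divr_ge0// mulr_ge0// sqr_ge0.
have [p0|p0] := leP 0 p; first by have := mulr_ge0 p0 t0; lra.
have pq : p ^+ 2 < 2 * q.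
  rewrite -(sqr_sqrtr (_ : 0 <= 2 * q)); last by rewrite mulr_ge0.
  rewrite -sqrrN ltr_pXn2r ?nnegrE ?sqrtr_ge0//; last by rewrite oppr_ge0 ltW.
  rewrite ltNge; apply/negP => h; apply: ncrit; split => //.
  by rewrite lerNr -mulrA.
have q1 : 0 < q by have := sqr_ge0 p; lra.
have : 0 < 2 * q * (1 + p * t + q * t ^+ 2 / 2).
  have -> : 2 * q * (1 + p * t + q * t ^+ 2 / 2) = (q * t + p) ^+ 2 + (2 * q - p ^+ 2).
    by field.
  by rewrite ltr_wpDl ?sqr_ge0// subr_gt0.
by rewrite pmulr_rgt0// mulr_gt0.
Qed.

(** By Vieta, [rt a / 2] and [l = (- p - d) / 2] have sum [- p] and product [k * n0 a / 2]; when
    nonzero, they are the reciprocals of the zeros of [J]. Factoring through reciprocals covers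
    [n0 a = 0], where [l = 0]. The second identity is the time derivative of the first. *)
Lemma jac_critical (a : R) : crit a -> exists2 l, 0 <= l <= rt a / 2 &
  forall t, J a t = (1 - rt a / 2 * t) * (1 - l * t) /\
    stretch k n0 u0 a t =
    - (rt a / 2 * (1 - l * t) + l * (1 - rt a / 2 * t)).
Proof.
move=> [a0]; rewrite /rate /jac /stretch.
set p := derive1 u0 a => pq.
have q0 : 0 <= 2 * k * n0 a.
  by rewrite mulr_ge0 ?(data_n0_ge0 hdata)// mulr_ge0// ltW.
have pN : 0 <= - p by have := sqrtr_ge0 (2 * k * n0 a); lra.
have D0 : 0 <= p ^+ 2 - 2 * k * n0 a.
  rewrite subr_ge0 -(sqr_sqrtr q0) -(sqrrN p) ler_pXn2r ?nnegrE ?sqrtr_ge0//.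
  by rewrite lerNr.
set d := Num.sqrt _; have d0 : 0 <= d := sqrtr_ge0 _.
have d2 : d ^+ 2 = p ^+ 2 - 2 * k * n0 a by rewrite sqr_sqrtr.
have dp : d <= - p.
  by rewrite -ler_sqr ?nnegrE// sqrrN d2 gerBl.
exists ((- p - d) / 2); first by apply/andP; split; lra.
have -> : n0 a = (p ^+ 2 - d ^+ 2) / 2 / k by rewrite d2; field; rewrite gt_eqF.
by move=> t; split; field; rewrite gt_eqF.
Qed.

Lemma rate_ge0 (a : R) : crit a -> 0 <= rt a.
Proof. by move=> /jac_critical[l /andP[l0 l1] _]; lra. Qed.

Lemma rate_gt0 (a : R) : crit a -> (n0 a, derive1 u0 a) <> (0, 0) -> 0 < rt a.
Proof.
move=> [a0]; rewrite /rate; set p := derive1 u0 a => pq nz.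
have s0 := sqrtr_ge0 (2 * k * n0 a).
have d0 := sqrtr_ge0 (p ^+ 2 - 2 * k * n0 a).
have [p0|p0|p0] := ltgtP p 0; [lra|lra|].
exfalso; apply: nz; rewrite p0; congr pair.
have h : 2 * k * n0 a <= 0 by rewrite -sqrtr_eq0 eq_le s0 andbT; lra.
apply/eqP; rewrite eq_le (data_n0_ge0 hdata a0) andbT.
by move: h; rewrite pmulr_rle0// mulr_gt0.
Qed.

(** The product form of [t < 2 / rt a] remains meaningful at rate 0, where it always holds. As
    [l <= rt a / 2], the other factor of [J] cannot vanish earlier. *)
Lemma jac_gt0P (T : \bar R) :
  (forall a t : R, 0 < a -> 0 <= t -> (t%:E < T)%E -> 0 < J a t) <->
  (forall a t : R, crit a -> 0 <= t -> (t%:E < T)%E -> rt a * t < 2).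
Proof.
split=> [H a t ca t0 tT|H a t a0 t0 tT].
  rewrite ltNge; apply/negP => h.
  have r0 : 0 < rt a.
    have r0 := rate_ge0 ca; rewrite lt_neqAle r0 andbT.
    by apply/negP => /eqP e; move: h; rewrite -e mul0r; lra.
  have [l _ /(_ (2 / rt a))[e _]] := jac_critical ca.
  have [a0 _] := ca.
  have t1 : 2 / rt a <= t by rewrite ler_pdivrMr// mulrC.
  have t2 : 0 <= 2 / rt a by rewrite divr_ge0// ltW.
  have := H a (2 / rt a) a0 t2 (ltT_le tT t1).
  rewrite e (_ : 1 - _ = 0) ?mul0r ?ltxx//; last by field; rewrite gt_eqF.
have [ca|] := pselect (crit a); last by move=> nca; exact: jac_noncritical.
have [l /andP[l0 l1] /(_ t)[-> _]] := jac_critical ca.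
have h := H a t ca t0 tT.
have l2 : l * t <= rt a / 2 * t by rewrite ler_wpM2r.
by apply: mulr_gt0; lra.
Qed.

(** Necessity is [jac_gt0], for an arbitrary solution; sufficiency is the explicit construction. *)
Lemma solution_existsP (T : \bar R) :
  (exists n u phi X, smooth_solution k n0 u0 T n u phi X) <->
  (forall a t : R, crit a -> 0 <= t -> (t%:E < T)%E -> rt a * t < 2).
Proof.
rewrite -jac_gt0P; split=> [[n [u [phi [X S]]]] a t|H]; first exact: (jac_gt0 hdata S).
by do 4 eexists; exact: (constructed_solution hk hdata H).
Qed.

(** A positive rate keeps the supremum away from 0 and [-oo]; if it is [+oo], the quotient is 0. *)
Lemma tc_fin (a : R) : crit a -> 0 < rt a ->
  exists2 c, 0 <= c & tc k n0 u0 = c%:E.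
Proof.
move=> ca r0.
have : ((rt a)%:E <= sup_rate k n0 u0 crit)%E by apply: ereal_sup_ubound; exists a.
rewrite /tc; case: (sup_rate k n0 u0 crit) => [s| |//].
  rewrite lee_fin => rs; have s0 : 0 < s by lra.
  exists (2 / s); first by rewrite divr_ge0// ltW.
  by rewrite inver gt_eqF// -EFinM.
by move=> _; exists 0 => //; rewrite invey mule0.
Qed.

Lemma tc_sup (a : R) : crit a -> 0 < rt a -> forall t : R, 0 < t ->
  (t%:E < tc k n0 u0)%E <-> ((sup_rate k n0 u0 crit) < (2 / t)%:E)%E.
Proof.
move=> ca r0 t t0.
have : ((rt a)%:E <= sup_rate k n0 u0 crit)%E by apply: ereal_sup_ubound; exists a.
rewrite /tc; case: (sup_rate k n0 u0 crit) => [s| |//].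
  rewrite lee_fin => rs; have s0 : 0 < s by lra.
  by rewrite inver gt_eqF// -EFinM !lte_fin ltr_pdivlMr// ltr_pdivlMr// mulrC.
by move=> _; rewrite invey mule0 lte_fin ltNge (ltW t0).
Qed.

Lemma tc_solution (a : R) : crit a -> 0 < rt a ->
  forall b t : R, crit b -> 0 <= t -> (t%:E < tc k n0 u0)%E -> rt b * t < 2.
Proof.
move=> ca r0 b t cb; rewrite le_eqVlt => /predU1P[<-|t0]; first by rewrite mulr0.
move/(tc_sup ca r0 t0) => h; rewrite -ltr_pdivlMr// -lte_fin.
by apply: le_lt_trans h; apply: ereal_sup_ubound; exists b.
Qed.

Lemma solution_le_tc (a : R) (T : \bar R) : crit a -> 0 < rt a ->
  (exists n u phi X, smooth_solution k n0 u0 T n u phi X) ->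
  (T <= tc k n0 u0)%E.
Proof.
move=> ca r0 /solution_existsP H; rewrite leNgt; apply/negP => tcT.
have [c c0 tcE] := tc_fin ca r0.
have [t ct tT] : exists2 t, c < t & (t%:E < T)%E.
  move: tcT; rewrite tcE; case: T {H} => [T|_|//]; last by exists (c + 1); rewrite ?ltry//; lra.
  by rewrite lte_fin => cT; exists ((c + T) / 2); rewrite ?lte_fin; lra.
have t0 : 0 < t by lra.
have t'0 : 0 < (c + t) / 2 by lra.
(* At a time beyond [c], [tc_sup] yields only a non-strict bound; applied at the midpoint of [c] and
   [t] it becomes strict at [t]. *)
have : ((2 / t)%:E < sup_rate k n0 u0 crit)%E.
  apply: (@lt_le_trans _ _ (2 / ((c + t) / 2))%:E).
    by rewrite lte_fin ltr_pM2l// ltf_pV2 ?posrE//; lra.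
  rewrite leNgt; apply/negP => /(tc_sup ca r0 t'0); rewrite tcE lte_fin; lra.
move=> /ereal_sup_gt[_ [b cb <-]]; rewrite lte_fin ltr_pdivrMr// => h.
by have := H b t cb (ltW t0) tT; rewrite ltNge (ltW h).
Qed.

End breakdown.

(** * Lifespan and divergence at the breakdown time *)

Section blowup.
Context (R : realType) (k : R) (n0 u0 : R -> R).
Hypothesis hk : 0 < k.
Hypothesis hdata : admissible_data n0 u0.

Local Notation rt := (rate k n0 u0).
Local Notation crit := (critical k n0 u0).
Local Notation T := (tc k n0 u0).

(** Without a positive rate the existence criterion holds with T = [+oo]; with one, every existence
    time is at most the finite [tc]. *)
Lemma blows_upP : blows_up k n0 u0 <-> exists2 a, crit a & 0 < rt a.
Proof.
split=> [|[a ca r0]].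
  apply: contraPP => /forall2NP nex; apply/negP; rewrite -leNgt.
  apply: ereal_sup_ubound; split; first exact: leey.
  apply/(solution_existsP hk hdata) => a t ca t0 _.
  have [nca|/negP] := nex a; first by case: (nca ca).
  rewrite -leNgt => r0.
  by rewrite (le_lt_trans (mulr_le0_ge0 r0 t0)).
rewrite /blows_up; have [c c0 e] := tc_fin ca r0.
apply: (@le_lt_trans _ _ T); last by rewrite e ltry.
by apply: ge_ereal_sup => S [_]; exact: (solution_le_tc hk hdata ca r0).
Qed.

Lemma lifespanE (a : R) : crit a -> 0 < rt a -> lifespan k n0 u0 = T.
Proof.
move=> ca r0; apply/eqP; rewrite eq_le; apply/andP; split.
  by apply: ge_ereal_sup => S [_]; exact: (solution_le_tc hk hdata ca r0).
apply: ereal_sup_ubound; split.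
  by have [c c0 ->] := tc_fin ca r0; rewrite lee_fin.
by apply/(solution_existsP hk hdata); exact: (tc_solution ca r0).
Qed.

(* In the limit rt a -> 2 / T the inequality reads 1 / (T - t) > M, that is
   t > T - 1 / M. *)
Lemma critical_label_near (A : set R) (M : R) : A `<=` crit ->
  sup_rate k n0 u0 A = sup_rate k n0 u0 crit ->
  (exists2 a, crit a & 0 < rt a) -> (0 < T)%E -> 0 < M ->
  \forall t \near (fine T)^'-, [/\ 0 <= t, (t%:E < T)%E &
    exists2 a, A a & M * (1 - rt a / 2 * t) < rt a / 2].
Proof.
move=> Acrit Asup [a ca r0] T0 M0.
have [c c0 Tc] := tc_fin ca r0; rewrite Tc /= in T0 *; rewrite lte_fin in T0.
near=> t.
have tc_ : t < c by near: t; exact: nbhs_left_lt.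
have t0 : 0 < t by near: t; exact: nbhs_left_gt.
have tM : c - 1 / M < t.
  by near: t; apply: nbhs_left_gt; rewrite ltrBlDr ltrDl divr_gt0.
rewrite lte_fin; split => //; first exact: ltW.
have h0 : 0 < t + 1 / M by rewrite addr_gt0// divr_gt0.
have : ((2 / (t + 1 / M))%:E < sup_rate k n0 u0 A)%E.
  have h1 : 0 < (c + (t + 1 / M)) / 2 by lra.
  rewrite Asup; apply: (@lt_le_trans _ _ (2 / ((c + (t + 1 / M)) / 2))%:E).
    by rewrite lte_fin ltr_pM2l// ltf_pV2 ?posrE//; lra.
  rewrite leNgt; apply/negP => /(tc_sup ca r0 h1); rewrite Tc lte_fin; lra.
move=> /ereal_sup_gt[_ [b Ab <-]]; rewrite lte_fin ltr_pdivrMr// => h.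
exists b => //.
have : M * 2 < M * (rt b * (t + 1 / M)) by rewrite ltr_pM2l.
have -> : M * (rt b * (t + 1 / M)) = M * rt b * t + rt b by field; rewrite gt_eqF.
by move=> ?; rewrite mulrBr; lra.
Unshelve. all: by end_near. Qed.

(** Write x and y for the two factors of [J], so that [u_r * x * y = - (rt a / 2 * y + l * x)]. From
    [M * x < rt a / 2] follows [M * x * y < rt a / 2 * y], and [l * x] only helps. *)
Lemma gradient_blowup (n u phi X : R -> R -> R) (a t M : R) :
  smooth_solution k n0 u0 T n u phi X -> crit a -> 0 <= t -> (t%:E < T)%E ->
  0 < M -> M * (1 - rt a / 2 * t) < rt a / 2 -> dr u (X a t) t < - M.
Proof.
move=> S ca t0 tT M0 h; have [a0 _] := ca.
have J0 := jac_gt0 hdata S a0 t0 tT.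
rewrite -(ltr_pM2r J0) (velocity_gradient hdata S)// -/(stretch k n0 u0 a t).
have [l /andP[l0 l1] /(_ t)[e1 ->]] := jac_critical hk hdata ca.
rewrite e1 in J0 *.
have l2 : l * t <= rt a / 2 * t by rewrite ler_wpM2r.
have x0 : 0 <= 1 - rt a / 2 * t.
  have := (jac_gt0P hk hdata T).1 (jac_gt0 hdata S) a t ca t0 tT; lra.
have y0 : 0 < 1 - l * t.
  rewrite lt0r; apply/andP; split; last lra.
  by apply: contraTneq J0 => ->; rewrite mulr0 ltxx.
rewrite mulNr ltrN2 mulrA.
have := mulr_ge0 l0 x0; have : M * (1 - rt a / 2 * t) * (1 - l * t) < rt a / 2 * (1 - l * t).
  by rewrite ltr_pM2r.
lra.
Qed.

(** The second factor of [J] is at most 1, so [M * J <= M * (1 - rt a / 2 * t) < c <= n0 a = n *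
    J]. *)
Lemma density_blowup (n u phi X : R -> R -> R) (a t c M : R) :
  smooth_solution k n0 u0 T n u phi X -> crit a -> 0 <= t -> (t%:E < T)%E ->
  c <= n0 a -> 0 <= M -> M * (1 - rt a / 2 * t) < c -> M < n (X a t) t.
Proof.
move=> S ca t0 tT ca0 M0 h; have [a0 _] := ca.
have J0 := jac_gt0 hdata S a0 t0 tT.
rewrite -(ltr_pM2r J0) (density_jac hdata S)//.
have [l /andP[l0 l1] /(_ t)[e1 _]] := jac_critical hk hdata ca.
rewrite e1; apply: le_lt_trans (lt_le_trans h ca0); rewrite ler_wpM2l//.
have x0 : 0 <= 1 - rt a / 2 * t.
  have := (jac_gt0P hk hdata T).1 (jac_gt0 hdata S) a t ca t0 tT; lra.
by rewrite ler_piMr// lerBlDr lerDl mulr_ge0.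
Qed.

End blowup.

(* The clause (n0 a, u0' a) <> (0, 0) is void where n0 > 0.  It removes the
   particles with n0 = u0' = 0, which satisfy the inequality and never blow up
   (rate 0, that is 2 / 0 = +oo); n0 = 0 with u0 constant is globally smooth.
   If tc = 0 there is no smooth solution on any time interval. *)
Theorem corollary5p5 (R : realType) (k : R) (n0 u0 : R -> R)
    (hk : 0 < k) (hdata : admissible_data n0 u0) :
  (blows_up k n0 u0 <->
     exists a : R, [/\ 0 < a,
       derive1 u0 a <= - Num.sqrt (2 * k * n0 a)
       & (n0 a, derive1 u0 a) <> (0, 0)]) /\
  (blows_up k n0 u0 ->
     lifespan k n0 u0 = tc k n0 u0 /\
     ((0 < tc k n0 u0)%E ->
        (exists n u phi X, smooth_solution k n0 u0 (tc k n0 u0) n u phi X) /\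
        (forall n u phi X, smooth_solution k n0 u0 (tc k n0 u0) n u phi X ->
           (forall M : R, \forall t \near (fine (tc k n0 u0))^'-,
              exists r : R, gas X t r /\ dr u r t < - M) /\
           (dense_criticality k n0 u0 ->
              forall M : R, \forall t \near (fine (tc k n0 u0))^'-,
                exists r : R, [/\ gas X t r, M < n r t & dr u r t < - M])))).
Proof.
split.
  split=> [/(blows_upP hk hdata)[a ca r0]|[a [a0 ha nz]]].
    have [a0 ha] := ca; exists a; split=> // -[n0a u0a].
    by move: r0; rewrite /rate n0a u0a mulr0 expr0n subrr sqrtr0 oppr0 addr0 ltxx.
  by apply/(blows_upP hk hdata); exists a => //; apply: rate_gt0.
move=> /(blows_upP hk hdata) ex; have [a ca r0] := ex.
split; first exact: (lifespanE hk hdata ca r0).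
move=> T0; split.
  by apply/(solution_existsP hk hdata); exact: (tc_solution ca r0).
move=> n u phi X S; have [c _ Tc] := tc_fin ca r0.
split=> [M|[d [d0 dsup]] M].
  (* [M] is an arbitrary real, whereas the estimates require a positive bound. *)
  have M0 : 0 < 1 + `|M| by rewrite ltr_pwDl.
  near=> t.
  have [t0 tT [b cb h]] : [/\ 0 <= t, (t%:E < tc k n0 u0)%E &
      exists2 b, critical k n0 u0 b &
        (1 + `|M|) * (1 - rate k n0 u0 b / 2 * t) < rate k n0 u0 b / 2].
    by near: t; exact: critical_label_near.
  have [b0 _] := cb; exists (X b t); split; first by exists b.
  have := gradient_blowup hk hdata S cb t0 tT M0 h.
  by have := ler_norm M; lra.
(* One label must serve both divergences. For [t > c / 2], the inequality [rate * t < 2] gives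
   [rate / 2 <= 2 / c]; then [L * x < rate / 2], with [x = 1 - rate / 2 * t], implies [|M| * x < d]
   for the density, while [|M| < L] handles the gradient. *)
pose L := 1 + `|M| + `|M| * (2 / c) / d.
rewrite Tc lte_fin in T0.
have c20 : 0 < 2 / c by rewrite divr_gt0.
have L1 : `|M| * (2 / c) / d <= L by rewrite lerDr addr_ge0.
have L2 : `|M| < L.
  have : 0 <= `|M| * (2 / c) / d by exact: divr_ge0 (mulr_ge0 (normr_ge0 M) (ltW c20)) (ltW d0).
  rewrite /L; lra.
clearbody L.
near=> t.
have [t0 tT [b [cb db] h]] : [/\ 0 <= t, (t%:E < tc k n0 u0)%E &
    exists2 b, (critical k n0 u0 `&` [set b | d <= n0 b]) b &
      L * (1 - rate k n0 u0 b / 2 * t) < rate k n0 u0 b / 2].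
  near: t; apply: critical_label_near => //.
    by rewrite Tc lte_fin.
  exact: le_lt_trans L2.
have tc2 : c / 2 < t by near: t; rewrite Tc /=; apply: nbhs_left_gt; lra.
have rb := tc_solution ca r0 cb t0 tT.
have rb0 := rate_ge0 hk hdata cb.
have [b0 _] := cb; exists (X b t); split; first by exists b.
  apply: le_lt_trans (ler_norm M) _.
  apply: (density_blowup hk hdata S cb t0 tT db) => //.
  have x0 : 0 <= 1 - rate k n0 u0 b / 2 * t by lra.
  have rc : rate k n0 u0 b / 2 <= 2 / c.
    rewrite ler_pdivlMr//.
    have : rate k n0 u0 b * (c / 2) <= rate k n0 u0 b * t by rewrite ler_wpM2l// ltW.
    lra.
  have : `|M| * (2 / c) / d * (1 - rate k n0 u0 b / 2 * t) < 2 / c.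
    apply: lt_le_trans rc; apply: le_lt_trans h.
    by rewrite ler_wpM2r.
  rewrite -(ltr_pM2l (divr_gt0 d0 c20)).
  set y := 1 - _; rewrite (_ : d / (2 / c) * _ = `|M| * y); last first.
    by field; rewrite !gt_eqF.
  by rewrite (_ : d / (2 / c) * _ = d)//; field; rewrite !gt_eqF.
have L0 : 0 < L := le_lt_trans (normr_ge0 M) L2.
have := gradient_blowup hk hdata S cb t0 tT L0 h.
by have := ler_norm M; lra.
Unshelve. all: by end_near. Qed.
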